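(* Let $\Phi:[0,\infty]\to[0,\infty]$ be a non-decreasing convex function such that, for every measurable function $\mu:\mathbb{D}\to\mathbb{D}$ satisfying $\int_{\mathbb{D}}\Phi(K_\mu(z))\,dx\,dy<\infty$, the Beltrami equation $f_{\bar z}=\mu(z)f_z$ has a homeomorphic ACL solution in $\mathbb{D}$. Then there is $\delta>0$ such that $$\int_\delta^\infty \log\Phi(t)\,\frac{dt}{t^2}=\infty.$$
   Context: $\mathbb{D}=\{z\in\mathbb{C}:|z|<1\}$. $f_{\bar z}=(f_x+if_y)/2$, $f_z=(f_x-if_y)/2$, and $K_\mu(z)=\frac{1+|\mu(z)|}{1-|\mu(z)|}$. A homeomorphic ACL solution is a homeomorphism $f:\mathbb{D}\to\mathbb{C}$ which is ACL (absolutely continuous on almost all segments parallel to the sides of every closed axis-parallel rectangle in $\mathbb{D}$) and satisfies the equation a.e. *)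

(* Defs.v *)
From HB Require Import structures.
From mathcomp Require Import all_boot all_order all_algebra.
From mathcomp Require Import all_classical all_reals all_analysis.
Set Implicit Arguments. Unset Strict Implicit. Unset Printing Implicit Defensive.
Import Order.TTheory GRing.Theory Num.Theory.
Import numFieldNormedType.Exports.
Local Open Scope classical_set_scope.
Local Open Scope ring_scope.

Section Defs.
Variable R : realType.

Definition cabs (z : R * R) : R := Num.sqrt (z.1 ^+ 2 + z.2 ^+ 2).

Definition cmul (z w : R * R) : R * R :=
  (z.1 * w.1 - z.2 * w.2, z.1 * w.2 + z.2 * w.1).

Definition cmuli (z : R * R) : R * R := (- z.2, z.1).

Definition disk : set (R * R) := [set z | cabs z < 1].

Definition dx (f : R * R -> R * R) (z : R * R) : R * R := 'D_((1, 0) : R * R) f z.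
Definition dy (f : R * R -> R * R) (z : R * R) : R * R := 'D_((0, 1) : R * R) f z.

Definition dzbar (f : R * R -> R * R) (z : R * R) : R * R :=
  2^-1 *: (dx f z + cmuli (dy f z)).
Definition dz (f : R * R -> R * R) (z : R * R) : R * R :=
  2^-1 *: (dx f z - cmuli (dy f z)).

Definition Kmu (mu : R * R -> R * R) (z : R * R) : R :=
  (1 + cabs (mu z)) / (1 - cabs (mu z)).

Definition abs_cont_on (a b : R) (g : R -> R * R) : Prop :=
  forall e : R, 0 < e -> exists2 d : R, 0 < d &
    forall (n : nat) (s t : 'I_n -> R),
      (forall i, a <= s i /\ s i <= t i /\ t i <= b) ->
      (forall i j, i != j -> t i <= s j \/ t j <= s i) ->
      \sum_(i < n) (t i - s i) < d ->
      \sum_(i < n) cabs (g (t i) - g (s i)) < e.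

Definition ACL (U : set (R * R)) (f : R * R -> R * R) : Prop :=
  forall a b c d : R,
    `[a, b]%classic `*` `[c, d]%classic `<=` U ->
    ({ae (@lebesgue_measure R), forall y, y \in `[c, d] ->
         abs_cont_on a b (fun x => f (x, y))}%E) /\
    ({ae (@lebesgue_measure R), forall x, x \in `[a, b] ->
         abs_cont_on c d (fun y => f (x, y))}%E).

Definition homeomorphism_on (U : set (R * R)) (f : R * R -> R * R) : Prop :=
  {within U, continuous f} /\ {in U &, injective f} /\
  exists g : R * R -> R * R,
    (forall z, U z -> g (f z) = z) /\ {within f @` U, continuous g}.

Definition leb2 := ((@lebesgue_measure R) \x (@lebesgue_measure R))%E.

Definition homeo_ACL_solution (mu f : R * R -> R * R) : Prop :=
  homeomorphism_on disk f /\ ACL disk f /\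
  {ae leb2, forall z, disk z ->
     derivable f z ((1, 0)%R : R * R) /\ derivable f z ((0, 1)%R : R * R) /\
     dzbar f z = cmul (mu z) (dz f z)}%E.

Definition eln (x : \bar R) : \bar R :=
  match x with
  | EFin r => if (0 < r)%R then EFin (ln r) else -oo%E
  | +oo%E => +oo%E
  | -oo%E => -oo%E
  end.

Definition nonneg_on_ext (Phi : \bar R -> \bar R) : Prop :=
  forall x, (0 <= x)%E -> (0 <= Phi x)%E.
Definition nondecr_on_ext (Phi : \bar R -> \bar R) : Prop :=
  forall x y, (0 <= x)%E -> (x <= y)%E -> (Phi x <= Phi y)%E.
Definition convex_on_ext (Phi : \bar R -> \bar R) : Prop :=
  forall (x y : \bar R) (t : R), (0 <= x)%E -> (0 <= y)%E -> 0 <= t <= 1 ->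
    (Phi (t%:E * x + (1 - t)%:E * y) <= t%:E * Phi x + (1 - t)%:E * Phi y)%E.

End Defs.

(* Main.v *)
Require Import Defs.
From HB Require Import structures.
From mathcomp Require Import all_boot all_order all_algebra.
From mathcomp Require Import all_classical all_reals all_analysis.
From mathcomp Require Import measurable_realfun.
From mathcomp Require Import lra ring zify.
Import Order.TTheory GRing.Theory Num.Theory.
Import numFieldNormedType.Exports.
Local Open Scope classical_set_scope.
Local Open Scope ring_scope.

(** If no [delta] works, then [Phi (2 ^ m) <= 2 ^ a m] for some [a] with
  [sum_m a m / 2 ^ m] finite, and this yields [K j >= 1] with both
  [sum_j 1 / K j] and [sum_j Phi (K j) / 4 ^ j] finite.  Let [s] be the
  contraction [z |-> - i z / 2] and [Q] the open quadrilateral bounded by the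
  lines [x = 1/8], [x = 1/4], [y = - x / 2], [y = 2 x].  The sets [s^j Q] are
  disjoint, and since [s] sends [(x, 2 x)] to [(x, - x / 2)], the images under
  the [s^j] of a vertical segment of [Q] join up to a polygon spiralling into
  the origin.  Give [mu] the dilatation [K j] on [s^j Q], so oriented that a
  solution [f] contracts along the spirals: [f_j = f o s^j] satisfies
  [d_y f_j = i / K j * d_x f_j] on [Q].  Restrict to the points where
  [|f - f 0| < r].  By the length-area principle the mean length of the images
  of the vertical segments under [f_j] is at most
  [C (lam area_j + 1 / (lam K j))] for each [lam > 0], where the areas sum to at
  most [4 r^2].  With [lam] a small multiple of [1 / r], summing over [j >= J]
  bounds the mean by less than [r / 8 = r * (1/4 - 1/8)] for [J] large; but for
  [r] small every spiral has to cross [|f - f 0| < r] from [r] down to [0]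
  inside the turns [j >= J].

  A homeomorphic ACL solution need not be known to be totally differentiable
  a.e., so the area estimate uses partial derivatives only.  If four edges of a
  small rectangle are mapped nearly affinely with orthogonal directions, then
  the Poincare-Miranda theorem puts a full square inside the image of the
  rectangle, and a double count of such squares over all corners replaces the
  change of variables formula. *)

(** * The Poincare-Miranda theorem in the plane *)

Definition mixed_cell (q : nat -> nat -> bool) (i j : nat) : bool :=
  [|| q i j, q i.+1 j, q i j.+1 | q i.+1 j.+1] &&
  [|| ~~ q i j, ~~ q i.+1 j, ~~ q i j.+1 | ~~ q i.+1 j.+1].

(** A parity argument in the manner of Sperner's lemma. Without a cell mixed for both labels, the
    number of counted edges in a horizontal row has a parity independent of the row; it is odd in
    the bottom row, where [q] passes from false to true and [p] is false, and it is zero in the top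
    row, where [p] is true. *)
Lemma exists_mixed_cell (n : nat) (p q : nat -> nat -> bool) : (0 < n)%N ->
  (forall i, (i <= n)%N -> ~~ p i 0%N) -> (forall i, (i <= n)%N -> p i n) ->
  (forall j, (j <= n)%N -> ~~ q 0%N j) -> (forall j, (j <= n)%N -> q n j) ->
  exists i j, [/\ (i < n)%N, (j < n)%N, mixed_cell p i j & mixed_cell q i j].
Proof.
move=> n0 p0 pn q0 qn; apply: contrapT => nomix.
pose e (i j i' j' : nat) := [&& ~~ p i j, ~~ p i' j' & (q i j (+) q i' j')].
(* Edges labelled by a sign change of [q] inside [~~ p]: every cell has an even number of them. *)
have cell i j : (i < n)%N -> (j < n)%N ->
    e i j i.+1 j (+) e i j.+1 i.+1 j.+1 = e i j i j.+1 (+) e i.+1 j i.+1 j.+1.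
  move=> ilt jlt; have : ~~ (mixed_cell p i j && mixed_cell q i j).
    by apply/negP => /andP[mp mq]; apply: nomix; exists i, j.
  rewrite /mixed_cell /e.
  case: (p i j); case: (p i.+1 j); case: (p i j.+1); case: (p i.+1 j.+1);
  case: (q i j); case: (q i.+1 j); case: (q i j.+1); case: (q i.+1 j.+1) => //=.
pose row j := \big[addb/false]_(0 <= i < n) e i j i.+1 j.
have rowS j : (j < n)%N -> row j.+1 = row j.
  move=> jlt.
  suff H m : (m <= n)%N -> (\big[addb/false]_(0 <= i < m) e i j i.+1 j) (+)
     (\big[addb/false]_(0 <= i < m) e i j.+1 i.+1 j.+1) =
      e 0%N j 0%N j.+1 (+) e m j m j.+1.
    have := H n (leqnn n); rewrite -/(row j) -/(row j.+1) {1 2}/e.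
    rewrite (negbTE (q0 _ (ltnW jlt))) (negbTE (q0 _ jlt)) (qn _ (ltnW jlt)) (qn _ jlt).
    by rewrite !addbb !andbF /=; case: (row j); case: (row j.+1).
  elim: m => [_|m IH mlt]; first by rewrite !big_geq //; case: (e _ _ _ _).
  rewrite !big_nat_recr //=.
  have := IH (ltnW mlt); have := cell m j mlt jlt.
  set A := \big[_/_]_(_ <= _ < _) _; set B := \big[_/_]_(_ <= _ < _) _.
  by case: A; case: B; case: (e m j m.+1 j); case: (e m j.+1 m.+1 j.+1);
    case: (e m j m j.+1); case: (e m.+1 j m.+1 j.+1); case: (e 0%N j 0%N j.+1).
have rowE j : (j <= n)%N -> row j = row 0%N.
  by elim: j => // j IH jlt; rewrite rowS // IH // ltnW.
have rown : row n = false.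
  rewrite /row big_nat big1 // => i /andP[_ ilt].
  by rewrite /e pn // ltnW.
have row0 m : (m <= n)%N -> \big[addb/false]_(0 <= i < m) e i 0%N i.+1 0%N = q m 0%N.
  elim: m => [_|m IH mlt]; first by rewrite big_geq // (negbTE (q0 _ (leq0n n))).
  rewrite big_nat_recr //= IH; last exact: ltnW.
  by rewrite /e (p0 _ (ltnW mlt)) (p0 _ mlt) /=; case: (q m 0%N); case: (q m.+1 0%N).
have := rowE n (leqnn n); rewrite rown /row row0 // qn //.
Qed.

Section PM.
Variable R : realType.

Lemma mixed_cell_pt (phi : R * R -> R) (g : nat -> nat -> R * R) i j (z : R * R) e :
  mixed_cell (fun i j => 0 <= phi (g i j)) i j ->
  (forall i' j', (i <= i' <= i.+1)%N -> (j <= j' <= j.+1)%N -> ball z e (g i' j')) ->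
  (exists2 w, ball z e w & 0 <= phi w) /\ (exists2 w, ball z e w & phi w < 0).
Proof.
move=> /andP[h1 h2] hb; split.
- by case/or4P: h1 => h; eexists; try exact: h; apply: hb; rewrite ?leqnn ?leqnSn.
- by case/or4P: h2 => h; eexists; rewrite ?ltNge; try exact: h; apply: hb; rewrite ?leqnn ?leqnSn.
Qed.

(** The grids of mesh [1 / n.+1] have cells on which both functions change sign. By compactness
    these cells cluster at a point, where continuity excludes a nonzero value of either function. *)
Lemma poincare_miranda (phi psi : R * R -> R) (x0 y0 h k : R) : 0 < h -> 0 < k ->
  (forall z, x0 <= z.1 <= x0 + h -> y0 <= z.2 <= y0 + k ->
     {for z, continuous phi} /\ {for z, continuous psi}) ->
  (forall y, y0 <= y <= y0 + k -> phi (x0, y) < 0 /\ 0 < phi (x0 + h, y)) ->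
  (forall x, x0 <= x <= x0 + h -> psi (x, y0) < 0 /\ 0 < psi (x, y0 + k)) ->
  exists z, [/\ x0 <= z.1 <= x0 + h, y0 <= z.2 <= y0 + k, phi z = 0 & psi z = 0].
Proof.
move=> h0 k0 cont bphi bpsi.
pose g (n i j : nat) : R * R := (x0 + h * (i%:R / n.+1%:R), y0 + k * (j%:R / n.+1%:R)).
pose Q : set (R * R) := `[x0, x0 + h]%classic `*` `[y0, y0 + k]%classic.
have frac (i n : nat) : (i <= n.+1)%N -> 0 <= (i%:R / n.+1%:R : R) /\ (i%:R / n.+1%:R : R) <= 1.
  by move=> le; rewrite divr_ge0 // ler_pdivrMr ?ltr0n // mul1r ler_nat.
have gQ n i j : (i <= n.+1)%N -> (j <= n.+1)%N -> Q (g n i j).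
  move=> ile jle; have [i0 i1] := frac i n ile; have [j0 j1] := frac j n jle; split; rewrite /g /= in_itv /=.
    by rewrite lerDl lerD2l mulr_ge0 ?ler_piMr // ltW.
  by rewrite lerDl lerD2l mulr_ge0 ?ler_piMr // ltW.
have key n : exists ij : nat * nat, [/\ (ij.1 < n.+1)%N, (ij.2 < n.+1)%N,
    mixed_cell (fun i j => 0 <= phi (g n i j)) ij.1 ij.2 &
    mixed_cell (fun i j => 0 <= psi (g n i j)) ij.1 ij.2].
  have e1 : n.+1%:R / n.+1%:R = 1 :> R by rewrite divff // pnatr_eq0.
  have [//|i le|i le|j le|j le|i [j [? ? ? ?]]] := @exists_mixed_cell n.+1
    (fun i j => 0 <= psi (g n i j)) (fun i j => 0 <= phi (g n i j)); last by exists (i, j).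
  - have [Q1 _] := gQ n i 0%N le isT; rewrite /= in_itv /= in Q1.
    by rewrite /g mul0r mulr0 addr0 -ltNge; exact: (bpsi _ Q1).1.
  - have [Q1 _] := gQ n i 0%N le isT; rewrite /= in_itv /= in Q1.
    by rewrite /g e1 mulr1; apply/ltW; exact: (bpsi _ Q1).2.
  - have [_ Q1] := gQ n 0%N j isT le; rewrite /= in_itv /= in Q1.
    by rewrite /g mul0r mulr0 addr0 -ltNge; exact: (bphi _ Q1).1.
  - have [_ Q1] := gQ n 0%N j isT le; rewrite /= in_itv /= in Q1.
    by rewrite /g e1 mulr1; apply/ltW; exact: (bphi _ Q1).2.
have [ij ijP] := choice key.
pose u n := g n (ij n).1 (ij n).2.
have uQ n : Q (u n) by have [? ? _ _] := ijP n; apply: gQ; exact: ltnW.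
have cQ : compact Q by apply: compact_setX; exact: segment_compact.
have FQ : (u @ \oo) Q by exists 0%N => // n _; exact: uQ.
have [z [Qz clz]] := cQ _ _ FQ.
have zx : x0 <= z.1 <= x0 + h by case: Qz; rewrite /= in_itv.
have zy : y0 <= z.2 <= y0 + k by case: Qz; rewrite /= in_itv.
(* Cells arbitrarily close to the cluster point [z] on which both functions change sign. *)
have close e : 0 < e -> exists n, forall i' j', ((ij n).1 <= i' <= (ij n).1.+1)%N ->
    ((ij n).2 <= j' <= (ij n).2.+1)%N -> ball z e (g n i' j').
  move=> e0.
  have e2 : 0 < e / 2 by rewrite divr_gt0.
  have hk : 0 < (h + k) / (e / 2) by rewrite divr_gt0 // addr_gt0.
  pose N := Num.truncn ((h + k) / (e / 2)).
  have NP : (h + k) / (e / 2) < N.+1%:R by rewrite truncnS_gt.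
  have FN : (u @ \oo) [set w | exists2 n, (N <= n)%N & w = u n].
    by exists N => // n Nn; exists n.
  have [w [[n Nn ->] bzu]] := clz _ _ FN (nbhsx_ballx z _ e2).
  exists n => i' j' hi hj; apply: (@ball_split _ _ (u n)) => //.
  have n1 : (h + k) / (e / 2) < n.+1%:R.
    by apply: lt_le_trans NP _; rewrite ler_nat.
  have n1' : h + k < n.+1%:R * (e / 2) by rewrite -ltr_pdivrMr.
  have n0 : 0 < n.+1%:R :> R by rewrite ltr0n.
  have step (c : R) (a b : nat) : 0 < c -> c <= h + k -> (a <= b <= a.+1)%N ->
      `|c * (a%:R / n.+1%:R) - c * (b%:R / n.+1%:R)| < e / 2.
    move=> c0 ch /andP[ab ba].
    rewrite -mulrBr -mulrBl normrM (ger0_norm (ltW c0)) normrM normfV (ger0_norm (ltW n0)).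
    rewrite mulrA ltr_pdivrMr // mulrC.
    have : `|a%:R - b%:R| <= 1 :> R.
      rewrite distrC -natrB // ger0_norm // -[1]/(1%:R) ler_nat leq_subLR addn1 //.
    by move=> ?; nra.
  rewrite /u /g; split => /=; rewrite /ball /= opprD addrACA subrr add0r.
    by apply: step => //; lra.
  by apply: step => //; lra.
have sgn (f : R * R -> R) : {for z, continuous f} ->
   (forall n, mixed_cell (fun i j => 0 <= f (g n i j)) (ij n).1 (ij n).2) -> f z = 0.
  move=> cf mix; apply/eqP; apply/negPn/negP => fz0.
  have : \forall w \near z, `|f z - f w| < `|f z|.
    by have /cvgrPdist_lt := cf; apply; rewrite normr_gt0.
  move=> /nbhs_ballP[e /= e0 be].
  have [n hn] := close e e0.
  have [[w1 b1 f1] [w2 b2 f2]] := mixed_cell_pt f (g n) _ _ _ _ (mix n) hn.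
  have := be _ b1; have := be _ b2; rewrite /=.
  case: (ltgtP (f z) 0) fz0 => // fz _.
  - by move=> _; rewrite (ltr0_norm fz) ler0_norm ?subr_le0; lra.
  - by rewrite (gtr0_norm fz) ger0_norm ?subr_ge0; lra.
exists z; have [cphi cpsi] := cont z zx zy; split => //.
  by apply: sgn => // n; have [] := ijP n.
by apply: sgn => // n; have [] := ijP n.
Qed.

End PM.

(** * Squares inside the image of a small rectangle *)

Section Plane.
Variable R : realType.
Implicit Types (u v w z p a : R * R) (F : R * R -> R * R).

Lemma norm_pairE z : `|z| = Num.max `|z.1| `|z.2|.
Proof. by rewrite prod_normE. Qed.

Lemma norm_pair_le z c : (`|z| <= c) = (`|z.1| <= c) && (`|z.2| <= c).
Proof. by rewrite norm_pairE ge_max. Qed.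

Lemma norm_pair_lt z c : (`|z| < c) = (`|z.1| < c) && (`|z.2| < c).
Proof. by rewrite norm_pairE gt_max. Qed.

Lemma norm_fst_le z : `|z.1| <= `|z|.
Proof. by rewrite norm_pairE le_max lexx. Qed.

Lemma norm_snd_le z : `|z.2| <= `|z|.
Proof. by rewrite norm_pairE le_max lexx orbT. Qed.

Definition dot u v : R := u.1 * v.1 + u.2 * v.2.

Lemma dotDr u v w : dot u (v + w) = dot u v + dot u w.
Proof. by rewrite /dot /=; ring. Qed.

Lemma dotNr u v : dot u (- v) = - dot u v.
Proof. by rewrite /dot /=; ring. Qed.

Lemma dotZr u (c : R) v : dot u (c *: v) = c * dot u v.
Proof. by rewrite /dot /= /GRing.scale /=; ring. Qed.

Lemma dot_le u v : `|dot u v| <= 2 * `|u| * `|v|.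
Proof.
rewrite /dot; apply: le_trans (ler_normD _ _) _; rewrite !normrM.
have := norm_fst_le u; have := norm_snd_le u; have := norm_fst_le v; have := norm_snd_le v.
have := normr_ge0 u.1; have := normr_ge0 u.2; have := normr_ge0 v.1; have := normr_ge0 v.2.
by move=> ? ? ? ? ? ? ? ?; nra.
Qed.

Lemma dot_self_ge u : `|u| ^+ 2 <= dot u u.
Proof.
rewrite /dot norm_pairE -!expr2 -(real_normK (num_real u.1)) -(real_normK (num_real u.2)).
rewrite /Num.max; case: ifP => _; rewrite ?lerDl ?lerDr sqr_ge0 //.
Qed.

Lemma continuous_dot u F z : {for z, continuous F} -> {for z, continuous (fun z => dot u (F z))}.
Proof.
move=> cF; rewrite /dot; apply: cvgD; apply: cvgM; try exact: cvg_cst.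
  by apply: (cvg_comp F fst cF); exact: cvg_fst.
by apply: (cvg_comp F snd cF); exact: cvg_snd.
Qed.

(* Multiplication by [-i]. *)
Definition mulNi u : R * R := (u.2, - u.1).

Lemma norm_mulNi u : `|mulNi u| = `|u|.
Proof. by rewrite !norm_pairE /= normrN maxC. Qed.

Lemma mulNiB u v : mulNi (u - v) = mulNi u - mulNi v.
Proof. by apply/eqP/andP; split; rewrite //= opprD. Qed.

Lemma dot_mulNi u v : dot (mulNi u) (mulNi v) = dot u v.
Proof. by rewrite /dot /=; ring. Qed.

Lemma dot_mulNil u : dot (mulNi u) u = 0.
Proof. by rewrite /dot /=; ring. Qed.

Lemma dot_mulNir u : dot u (mulNi u) = 0.
Proof. by rewrite /dot /=; ring. Qed.

(** The Poincare-Miranda theorem is applied to the components of [F z - w] along [mulNi a] and [a].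
    For the exact affine map these equal at least [|a| ^ 2 * h / 2] in absolute value, with opposite
    signs, on opposite edges. Each error of size [|a| * h / 16] costs at most [|a| ^ 2 * h / 8]
    after [dot_le], and at most three of them add up: two edges and the offset of [w] from the
    centre. *)
Lemma square_in_image F p a (h k : R) : 0 < h -> 0 < k -> a != 0 ->
  (forall z, p.1 <= z.1 <= p.1 + k * h -> p.2 <= z.2 <= p.2 + h -> {for z, continuous F}) ->
  (forall t : R, 0 <= t <= h ->
     `|F (p.1 + k * t, p.2) - F p - t *: mulNi a| <= `|a| * h / 16) ->
  (forall t : R, 0 <= t <= h -> `|F (p.1, p.2 + t) - F p - t *: a| <= `|a| * h / 16) ->
  (forall t : R, 0 <= t <= h ->
     `|F (p.1 + k * h, p.2 + t) - F (p.1 + k * h, p.2) - t *: a| <= `|a| * h / 16) ->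
  (forall t : R, 0 <= t <= h ->
     `|F (p.1 + k * t, p.2 + h) - F (p.1, p.2 + h) - t *: mulNi a| <= `|a| * h / 16) ->
  forall w, `|w - (F p + (h / 2) *: (a + mulNi a))| <= `|a| * h / 16 ->
  exists z, [/\ p.1 <= z.1 <= p.1 + k * h, p.2 <= z.2 <= p.2 + h & F z = w].
Proof.
move=> h0 k0 a0 cF Hb Hl Hr Ht w Hw.
have N0 : 0 < `|a| by rewrite normr_gt0.
pose b := mulNi a.
pose d := w - (F p + (h / 2) *: (a + b)).
have wE : w = F p + (h / 2) *: (a + b) + d by rewrite /d addrC subrK.
have small u e : `|u| = `|a| -> `|e| <= `|a| * h / 16 -> `|dot u e| <= `|a| ^+ 2 * h / 8.
  move=> ua ea; apply: le_trans (dot_le _ _) _; rewrite ua.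
  by move: (`|e|) ea => E ea; rewrite expr2; nra.
have Sa := dot_self_ge a.
have sb := norm_mulNi a.
have da := small a d erefl Hw; have db := small b d sb Hw.
have hh : 0 <= h <= h by rewrite ltW // lexx.
have pos : 0 < `|a| ^+ 2 * h by rewrite mulr_gt0 // exprn_gt0.
have Sa' : `|a| ^+ 2 * h <= dot a a * h by rewrite ler_pM2r.
have base u : dot u (F p - w) = - (h / 2 * (dot u a + dot u b)) - dot u d.
  by rewrite {1}wE opprD addrA opprD addrA subrr sub0r !(dotDr, dotNr, dotZr).
have [|||z [z1 z2 f1 f2]] := @poincare_miranda R (fun z => dot b (F z - w)) (fun z => dot a (F z - w))
   p.1 p.2 (k * h) h (mulr_gt0 k0 h0) h0.
- move=> z z1 z2; have c : {for z, continuous (fun z => F z - w)}.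
    by apply: cvgB; [exact: cF | exact: cvg_cst].
  by split; apply: continuous_dot.
- move=> y yP; pose t := y - p.2.
  have tP : 0 <= t <= h by rewrite /t; lra.
  have yE : y = p.2 + t by rewrite /t addrC subrK.
  have e1 := small b _ sb (Hl t tP); have e2 := small b _ sb (Hr t tP).
  have e3 := small b _ sb (Hb h hh).
  have bE := base b; rewrite dot_mulNi dot_mulNil in bE.
  rewrite yE; move: e1 e2 e3 bE da db.
  rewrite !(dotDr, dotNr, dotZr) !dot_mulNi !dot_mulNil.
  rewrite !ler_norml => /andP[? ?] /andP[? ?] /andP[? ?] ? /andP[? ?] /andP[? ?].
  by split; lra.
- move=> x xP; pose t := (x - p.1) / k.
  have xE : x = p.1 + k * t by rewrite /t mulrC divfK ?gt_eqF // addrC subrK.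
  have tP : 0 <= t <= h.
    by apply/andP; split; rewrite /t ?ler_pdivrMr // ?divr_ge0 ?(ltW k0) //; lra.
  have e1 := small a _ erefl (Hb t tP); have e2 := small a _ erefl (Ht t tP).
  have e3 := small a _ erefl (Hl h hh).
  have bE := base a; rewrite dot_mulNir in bE.
  rewrite xE; move: e1 e2 e3 bE da db.
  rewrite !(dotDr, dotNr, dotZr) !dot_mulNir.
  rewrite !ler_norml => /andP[? ?] /andP[? ?] /andP[? ?] ? /andP[? ?] /andP[? ?].
  by split; lra.
exists z; split => //; apply/eqP; rewrite -subr_eq0; apply/eqP.
have : 0 < dot a a by apply: lt_le_trans Sa; rewrite exprn_gt0.
move: f1 f2; rewrite /dot /b; case: (F z - w) => x y /= f1 f2 S0.
have /eqP : (a.1 * a.1 + a.2 * a.2) * x = 0.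
  transitivity (a.1 * (a.1 * x + a.2 * y) + a.2 * (a.2 * x + - a.1 * y)); first by ring.
  by rewrite f1 f2 !mulr0 addr0.
have /eqP : (a.1 * a.1 + a.2 * a.2) * y = 0.
  transitivity (a.2 * (a.1 * x + a.2 * y) - a.1 * (a.2 * x + - a.1 * y)); first by ring.
  by rewrite f1 f2 !mulr0 subr0.
by rewrite !mulf_eq0 !(gt_eqF S0) /= => /eqP -> /eqP ->.
Qed.

End Plane.

Arguments dot {R}.
Arguments mulNi {R}.

(** * Outer Lebesgue measure on the line *)

Section Line.
Variable R : realType.
Local Notation mu := (@lebesgue_measure R).

Lemma nneseries_le_bound (u : nat -> \bar R) (c : \bar R) :
  (forall n, 0 <= u n)%E -> (forall n, \sum_(i < n) u i <= c)%E ->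
  (\sum_(i <oo) u i <= c)%E.
Proof.
move=> u0 uc; apply: lime_le; first by apply: is_cvg_nneseries.
by apply: nearW => n; rewrite big_mkord.
Qed.

Lemma ae_mono (P Q : R -> Prop) : (forall x, P x -> Q x) ->
  {ae mu, forall x, P x} -> {ae mu, forall x, Q x}.
Proof.
move=> PQ [A [mA A0 PA]]; exists A; split => // x nQ.
by apply: PA => /= Px; apply: nQ; exact: PQ.
Qed.

Lemma ae_and (P Q : R -> Prop) : {ae mu, forall x, P x} ->
  {ae mu, forall x, Q x} -> {ae mu, forall x, P x /\ Q x}.
Proof.
move=> [A [mA A0 PA]] [B [mB B0 QB]].
have /negligibleS : mu.-negligible (A `|` B).
  by apply: negligibleU; [exists A; split => // | exists B; split => //].
apply => x /= nPQ; have [Px|nPx] := pselect (P x); last by left; exact: PA.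
by right; apply: QB => Qx; exact: nPQ.
Qed.

Lemma ae_forall (P : nat -> R -> Prop) : (forall n, {ae mu, forall x, P n x}) ->
  {ae mu, forall x, forall n, P n x}.
Proof.
move=> H; have /negligibleS : mu.-negligible (\bigcup_n [set x | ~ P n x]).
  by apply: negligible_bigcup => n; exact: H.
by apply => x /= /existsNP[n nP]; exists n.
Qed.

(** On arbitrary sets [lebesgue_measure] is the outer measure of its construction. Monotonicity and
    subadditivity are thus available for images of sets, whose measurability is not established. *)
Lemma lebesgue_outer_le (A B : set R) : A `<=` B -> (mu A <= mu B)%E.
Proof. by move=> AB; exact: le_mu_ext. Qed.

Lemma lebesgue_outer_bigcup (A : nat -> set R) :
  (mu (\bigcup_i A i) <= \sum_(i <oo) mu (A i))%E.
Proof. exact: outer_measure_sigma_subadditive. Qed.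

Lemma lebesgue_outer_setU (A B : set R) : (mu (A `|` B) <= mu A + mu B)%E.
Proof.
rewrite /lebesgue_measure /lebesgue_stieltjes_measure /measure_extension.
exact: outer_measureU2.
Qed.

Lemma lebesgue_open_approx (A : set R) (e : R) : 0 < e ->
  exists U, [/\ open U, A `<=` U & (mu U <= mu A + e%:E)%E].
Proof. exact: outer_measure_open_le. Qed.

Lemma interval_dist_le (I : set R) x y : is_interval I -> I x -> I y ->
  (`|x - y|%:E <= mu I)%E.
Proof.
move=> iI Ix Iy.
wlog xy : x y Ix Iy / x <= y.
  by move=> H; case: (leP x y) => [|/ltW] h; [exact: H|rewrite distrC; exact: H].
have : `[x, y]%classic `<=` I.
  by move=> z; rewrite /= in_itv  => xz; apply: (iI _ _ Ix Iy).
move=> /lebesgue_outer_le; apply: le_trans.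
rewrite lebesgue_measure_itv /= lte_fin distrC ger0_norm ?subr_ge0 //.
by case: ltgtP xy => // -> _; rewrite subrr.
Qed.

Lemma lebesgue_ball_cover (A : set R) (c l : R) : 0 <= l ->
  (forall x, A x -> `|x - c| <= l) -> (mu A <= (2 * l)%:E)%E.
Proof.
move=> l0 Al; apply: (@le_trans _ _ (mu `[c - l, c + l]%classic)).
  apply: lebesgue_outer_le => x /Al; rewrite ler_norml /= in_itv /= => /andP[? ?].
  by apply/andP; split; lra.
rewrite lebesgue_measure_itv /= lte_fin; case: ifP => _; last by rewrite lee_fin; lra.
by rewrite -EFinB lee_fin; lra.
Qed.

(** Cover [E] by an open set of nearly the same measure. On each component the image lies within [L]
    times its length of the image of a single point; centring the covering interval at that image
    costs the factor 2. *)
Lemma lebesgue_lipschitz_image (E : set R) (g : R -> R) (L : R) : 0 < L ->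
  (forall x y, E x -> E y -> `|g x - g y| <= L * `|x - y|) ->
  (mu (g @` E) <= (2 * L)%:E * mu E)%E.
Proof.
move=> L0 gL.
have L20 : 0 < 2 * L by lra.
have [muE|] := ltP (mu E) +oo%E; last first.
  by rewrite leye_eq => /eqP ->; rewrite gt0_muley ?lte_fin // leey.
apply/lee_addgt0Pr => e e0.
have d0 : 0 < e / (2 * L) by rewrite divr_gt0.
have [U [oU EU Ue]] := lebesgue_open_approx E _ d0.
have Ufin : (mu U < +oo)%E by apply: le_lt_trans Ue _; rewrite lte_add_pinfty // ltry.
pose I := open_disjoint_itv oU.
have iI q : is_interval (I q) by exact: open_disjoint_itv_is_interval.
have mI q : measurable (I q) by apply: open_measurable; exact: open_disjoint_itv_open.
have UE : U = \bigcup_q I q by exact: open_disjoint_itv_bigcup.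
have Ifin q : (mu (I q) < +oo)%E.
  by apply: le_lt_trans Ufin; apply: lebesgue_outer_le; rewrite UE; exact: bigcup_sup.
have piece q : (mu (g @` (E `&` I q)) <= (2 * L)%:E * mu (I q))%E.
  have [->|/set0P[x0 [Ex0 Ix0]]] := eqVneq (E `&` I q) set0.
    by rewrite image_set0 measure0 mule_ge0 // lee_fin ltW.
  have /fineK mIE : mu (I q) \is a fin_num by rewrite ge0_fin_numE.
  rewrite -mIE -EFinM -mulrA.
  apply: (@lebesgue_ball_cover _ (g x0)).
    by rewrite mulr_ge0 ?(ltW L0) // fine_ge0.
  move=> _ [x [Ex Ix] <-]; apply: le_trans (gL _ _ Ex Ex0) _.
  rewrite ler_pM2l // -lee_fin mIE; exact: interval_dist_le.
have -> : g @` E = \bigcup_q (g @` (E `&` I q)).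
  by rewrite -image_bigcup -setI_bigcupr -UE; congr (_ @` _); apply/esym/setIidPl.
apply: le_trans (lebesgue_outer_bigcup _) _.
apply: (@le_trans _ _ (\sum_(q <oo) ((2 * L)%:E * mu (I q)))%E).
  by apply: lee_nneseries => // q _; exact: mu_ext_ge0.
rewrite nneseriesZl //.
rewrite -measure_semi_bigcup //; last 2 first.
- exact: open_disjoint_itv_trivIset.
- by rewrite -UE; apply: open_measurable.
rewrite -UE; apply: (@le_trans _ _ ((2 * L)%:E * (mu E + (e / (2 * L))%:E))%E).
  by rewrite lee_wpmul2l // lee_fin ltW.
rewrite ge0_muleDr ?lee_fin ?(ltW d0) //.
rewrite -EFinM (_ : (2 * L * (e / (2 * L)) = e)%R) //.
by rewrite [LHS]mulrC divfK // gt_eqF.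
Qed.

(** Half-open blocks of length [d] keep two points of one block at distance less than [d]. The
    blocks cut [E] into disjoint measurable parts, so summing over them loses nothing; the lower
    bound [m] lets them be indexed by the naturals. *)
Lemma lebesgue_locally_lipschitz_image (E : set R) (g : R -> R) (L d m : R) :
  0 < L -> 0 < d -> measurable E -> E `<=` `[m, +oo[%classic ->
  (forall x y, E x -> E y -> `|x - y| < d -> `|g x - g y| <= L * `|x - y|) ->
  (mu (g @` E) <= (2 * L)%:E * mu E)%E.
Proof.
move=> L0 d0 mE Em gL.
pose B (k : nat) : set R := `[m + k%:R * d, m + k.+1%:R * d[%classic.
have mB k : measurable (E `&` B k) by apply: measurableI => //; exact: measurable_itv.
have BE : E = \bigcup_k (E `&` B k).
  rewrite -setI_bigcupr; apply/esym/setIidPl => x /Em; rewrite /= in_itv /= andbT => mx.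
  exists (Num.truncn ((x - m) / d)) => //; rewrite /B /= in_itv /=.
  have q0 : 0 <= (x - m) / d by rewrite divr_ge0 ?subr_ge0 // ltW.
  have := truncn_le ((x - m) / d); rewrite q0 => h1.
  have h2 := truncnS_gt ((x - m) / d).
  apply/andP; split.
    by rewrite -lerBrDl -ler_pdivlMr.
  by rewrite -ltrBlDl -ltr_pdivrMr.
have tB : trivIset setT (fun k => E `&` B k).
  apply: ltn_trivIset => j i ij; rewrite -subset0 => x [[_ xj] [_ xi]].
  move: xj xi; rewrite /B /= !in_itv /= => /andP[_ h1] /andP[h2 _].
  have : i.+1%:R * d <= j%:R * d by rewrite ler_pM2r // ler_nat.
  by move: h1 h2; set u := i.+1%:R * d; set v := j%:R * d; lra.
rewrite [in X in (_ <= X)%E]BE measure_semi_bigcup //; last by rewrite -BE.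
rewrite {1}BE image_bigcup; apply: le_trans (lebesgue_outer_bigcup _) _.
rewrite -nneseriesZl; last by move=> *; exact: mu_ext_ge0.
apply: lee_nneseries => [k _ _|k _]; first exact: mu_ext_ge0.
apply: lebesgue_lipschitz_image => // x y [Ex Bx] [Ey By]; apply: gL => //.
move: Bx By; rewrite /B /= !in_itv /= -natr1 mulrDl mul1r => /andP[? ?] /andP[? ?].
by rewrite ltr_norml; apply/andP; split; lra.
Qed.

Lemma lebesgue_affine_preimage0 (A : set R) (c d : R) : c != 0 -> mu A = 0%E ->
  mu [set x | A (c * x + d)] = 0%E.
Proof.
move=> c0 A0; apply/eqP; rewrite eq_le measure_ge0 andbT.
have -> : [set x | A (c * x + d)] = (fun y => (y - d) / c) @` A.
  apply/seteqP; split => [x Ax|_ [y Ay <-]] /=.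
    by exists (c * x + d) => //; rewrite addrK mulrC mulKf.
  by rewrite mulrC divfK // subrK.
apply: (@le_trans _ _ ((2 * `|c^-1|)%:E * mu A)%E); last by rewrite A0 mule0.
apply: lebesgue_lipschitz_image; first by rewrite normr_gt0 invr_eq0.
by move=> x y _ _; rewrite -mulrBl opprB addrA subrK normrM mulrC.
Qed.

Lemma lebesgue_translate_le (A : set R) (t : R) :
  (mu [set x | A (x + t)%R] <= 2%:E * mu A)%E.
Proof.
have -> : [set x | A (x + t)] = (fun y => y - t) @` A.
  apply/seteqP; split => [x Ax|_ [y Ay <-]] /=; last by rewrite subrK.
  by exists (x + t) => //; rewrite addrK.
have := @lebesgue_lipschitz_image A (fun y => y - t) 1 ltr01.
by rewrite mulr1; apply => x y _ _; rewrite opprB addrA subrK mul1r.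
Qed.

Lemma cabsN (z : R * R) : cabs (- z) = cabs z.
Proof. by rewrite /cabs /= !sqrrN. Qed.

(* Lusin's property (N). *)
Lemma abs_cont_image_null (a b : R) (c : R -> R * R) (g : R -> R) (N : set R) :
  abs_cont_on a b c -> (forall s t, `|g s - g t| <= cabs (c s - c t)) ->
  N `<=` `[a, b]%classic -> mu N = 0%E -> mu (g @` N) = 0%E.
Proof.
move=> ac gc Nab N0; apply/eqP; rewrite eq_le measure_ge0 andbT.
apply/lee_addgt0Pr => e e0; rewrite add0e.
have [->|/set0P[n0 Nn0]] := eqVneq N set0; first by rewrite image_set0 measure0 lee_fin ltW.
have ab : a <= b by have := Nab _ Nn0; rewrite /= in_itv => /andP[]; exact: le_trans.
have e4 : 0 < e / 4 by rewrite divr_gt0.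
have [d d0 acd] := ac _ e4.
have d2 : 0 < d / 2 by rewrite divr_gt0.
have [U [oU NU Ud]] := lebesgue_open_approx N _ d2; rewrite N0 add0e in Ud.
pose I := open_disjoint_itv oU.
have iI q : is_interval (I q) by exact: open_disjoint_itv_is_interval.
have mI q : measurable (I q) by apply: open_measurable; exact: open_disjoint_itv_open.
have UE : U = \bigcup_q I q by exact: open_disjoint_itv_bigcup.
have tI : trivIset setT I by exact: open_disjoint_itv_trivIset.
have abI q x : (N `&` I q) x -> a <= x <= b by case=> /Nab; rewrite /= in_itv.
have Iq_le q : (mu (I q) <= (d / 2)%:E)%E.
  by apply: le_trans Ud; apply: lebesgue_outer_le; rewrite UE; exact: bigcup_sup.
(* In each component of [U], two points of [N] are chosen whose values of [g] differ by at least a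
   quarter of the measure of the image. The intervals between them are the disjoint family tested
   against absolute continuity; a component missing [N] gets the degenerate interval at [a]. *)
have pick q : exists st : R * R,
    [/\ a <= st.1, st.1 <= st.2, st.2 <= b,
        (st = (a, a)) \/ (I q st.1 /\ I q st.2) &
        (mu (g @` (N `&` I q)) <= (4 * `|g st.2 - g st.1|)%:E)%E].
  have [->|/set0P[x0 NI0]] := eqVneq (N `&` I q) set0.
    exists (a, a); split => //=; first by left.
    by rewrite image_set0 measure0 lee_fin mulr_ge0.
  pose S := [set `|g x - g x0| | x in N `&` I q].
  have dist x y : I q x -> I q y -> `|x - y| < d.
    move=> Ix Iy; have := interval_dist_le _ _ _ (iI q) Ix Iy.
    by move=> /le_trans /(_ (Iq_le q)); rewrite lee_fin; lra.
  (* Absolute continuity for one interval: it makes the supremum of [S] finite. *)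
  have ubS : ubound S (e / 4).
    move=> _ [x NIx <-].
    have := acd 1%N (fun=> Num.min x x0) (fun=> Num.max x x0).
    rewrite !big_ord1; have [] := (abI _ _ NIx, abI _ _ NI0).
    move=> /andP[ax xb] /andP[ax0 x0b] H; apply: (le_trans (gc _ _)); apply: ltW.
    have dd : Num.max x x0 - Num.min x x0 < d.
      have := dist _ _ NIx.2 NI0.2.
      by case: (leP x x0) => h; [rewrite distrC ger0_norm ?subr_ge0|rewrite ger0_norm ?subr_ge0 // ltW].
    have {H} := H _ _ dd.
    have -> : cabs (c x - c x0) = cabs (c (Num.max x x0) - c (Num.min x x0)).
      by case: leP => // _; rewrite -cabsN opprB.
    apply; last by move=> i j; rewrite !ord1 eqxx.
    by move=> _; rewrite le_min ge_max ge_min le_max lexx ax ax0 xb x0b /=.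
  have S0 : S 0 by exists x0 => //; rewrite subrr normr0.
  have hS : has_sup S by split; [exists 0|exists (e / 4)].
  have supS x : (N `&` I q) x -> `|g x - g x0| <= sup S.
    by move=> NIx; apply: ub_le_sup; [exact: hS.2|exists x].
  have [y NIy gy] : exists2 y, (N `&` I q) y & sup S <= 2 * `|g y - g x0|.
    have s0 : 0 <= sup S by rewrite -(normr0 R) -(subrr (g x0)); exact: supS.
    move: s0; rewrite le_eqVlt => /predU1P[s0|s0].
      by exists x0 => //; rewrite -s0 subrr normr0 mulr0.
    have s2 : 0 < sup S / 2 by lra.
    have [_ [y NIy <-] hy] := sup_adherent s2 hS.
    by exists y => //; lra.
  exists (Num.min x0 y, Num.max x0 y).
  have /andP[ax0 x0b] := abI _ _ NI0; have /andP[ay yb] := abI _ _ NIy.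
  split => /=.
  - by rewrite le_min ax0.
  - by rewrite ge_min !le_max lexx.
  - by rewrite ge_max x0b yb.
  - by right; case: leP => _; split; case: NI0; case: NIy.
  - have -> : `|g (Num.max x0 y) - g (Num.min x0 y)| = `|g y - g x0|.
      by case: leP => // _; rewrite distrC.
    apply: (@le_trans _ _ (2 * sup S)%:E); last by rewrite lee_fin; lra.
    apply: (@lebesgue_ball_cover _ (g x0)).
      by rewrite -(normr0 R) -(subrr (g x0)); exact: supS.
    by move=> _ [x NIx <-]; exact: supS.
have [st stP] := choice pick.
have -> : g @` N = \bigcup_q (g @` (N `&` I q)).
  by rewrite -image_bigcup -setI_bigcupr -UE; congr (_ @` _); apply/esym/setIidPl.
apply: le_trans (lebesgue_outer_bigcup _) _.
apply: nneseries_le_bound => // n.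
apply: (@le_trans _ _ (\sum_(i < n) (4 * `|g (st i).2 - g (st i).1|)%:E)%E).
  by apply: lee_sum => i _; have [] := stP i.
rewrite sumEFin lee_fin -mulr_sumr -ler_pdivlMl // mulrC; apply: ltW.
apply: (@le_lt_trans _ _ (\sum_(i < n) cabs (c (st i).2 - c (st i).1))).
  by apply: ler_sum => i _; exact: gc.
apply: acd.
- by move=> i; have [-> -> -> _ _] := stP i.
- move=> i j ij.
  have [a1 l1 _ h1 _] := stP i; have [a2 l2 _ h2 _] := stP j.
  case: h1 => [E|[Is1 It1]]; first by left; rewrite E.
  case: h2 => [E|[Is2 It2]]; first by right; rewrite E.
  case: (leP (st i).2 (st j).1) => h; first by left.
  case: (leP (st j).2 (st i).1) => h'; first by right.
  have nIJ x : I i x -> I j x -> False.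
    move=> Iix Ijx; move/negP: ij; apply; apply/eqP; apply: val_inj => /=.
    by apply: tI => //; exists x.
  exfalso; case: (leP (st i).1 (st j).1) => h3.
    by apply: (nIJ (st j).1) => //; apply: (iI i _ _ Is1 It1); rewrite h3 ltW.
  by apply: (nIJ (st i).1) => //; apply: (iI j _ _ Is2 It2); rewrite (ltW h3) ltW.
- rewrite -lte_fin -sumEFin; apply: (@le_lt_trans _ _ (d / 2)%:E); last by rewrite lte_fin; lra.
  apply: le_trans Ud.
  apply: (@le_trans _ _ (\sum_(i < n) mu (I i))%E).
    apply: lee_sum => i _; have [_ l1 _ [E|[h1 h2]] _] := stP i.
      by rewrite E subrr measure_ge0.
    by rewrite -(ger0_norm (_ : 0 <= (st i).2 - (st i).1)) ?subr_ge0 //; exact: interval_dist_le.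
  rewrite UE measure_semi_bigcup //; last by rewrite -UE; apply: open_measurable.
  rewrite -(big_mkord xpredT (fun i => mu (I i))).
  by apply: nneseries_lim_ge => k _ _; exact: measure_ge0.
Qed.

End Line.

(** * Lebesgue measure on the plane *)

Section PlaneMeasure.
Variable R : realType.
Local Notation mu := (@lebesgue_measure R).
Local Notation mu2 := (@leb2 R).
Implicit Types A U : set (R * R).

Definition box (a b c d : R) : set (R * R) :=
  `[a, b]%classic `*` `[c, d]%classic.

Lemma measurable_box a b c d : measurable (box a b c d).
Proof. by apply: measurableX; exact: measurable_itv. Qed.

Lemma compact_box a b c d : compact (box a b c d).
Proof. by apply: compact_setX; exact: segment_compact. Qed.

Lemma box0 : box 1 0 1 0 = set0.
Proof. by rewrite /box set_itv_ge ?set0X // bnd_simp -ltNge ltr01. Qed.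

(** The boxes have rational centres and half-sides [1 / n.+1]; codes of boxes not contained in [U]
    are sent to the empty box. Compactness of the boxes matters for images under continuous maps. *)
Lemma open_bigcup_box U : open U ->
  exists q : nat -> (R * R) * (R * R),
    U = \bigcup_i (box (q i).1.1 (q i).1.2 (q i).2.1 (q i).2.2).
Proof.
move=> oU.
pose bx (t : rat * rat * nat) : (R * R) * (R * R) :=
  let d := t.2.+1%:R^-1 in
  ((ratr t.1.1 - d, ratr t.1.1 + d), (ratr t.1.2 - d, ratr t.1.2 + d)).
pose q i := if unpickle i is Some t then
    if `[< box (bx t).1.1 (bx t).1.2 (bx t).2.1 (bx t).2.2 `<=` U >] then bx t
    else ((1, 0), (1, 0)) else ((1, 0), (1, 0)).
exists q; apply/seteqP; split => [z Uz|z [i _]]; last first.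
  rewrite /q; case: (unpickle i) => [t|]; last by rewrite box0.
  by case: asboolP => [H /H//|_]; rewrite box0.
have /nbhs_ballP[e /= e0 eU] := oU _ Uz.
have [n nP] : exists n : nat, n.+1%:R^-1 < e / 2.
  exists (Num.truncn (e / 2)^-1).
  have e2 : 0 < e / 2 by rewrite divr_gt0.
  by rewrite -[ltRHS]invrK ltf_pV2 ?posrE ?invr_gt0 ?ltr0n // truncnS_gt.
have d0 : 0 < n.+1%:R^-1 :> R by rewrite invr_gt0 ltr0n.
set d : R := n.+1%:R^-1 in nP d0.
have [q1 q1P] : exists q1 : rat, z.1 - d < ratr q1 < z.1 + d.
  have [q1 q1P] := @rat_in_itvoo R (z.1 - d) (z.1 + d) ltac:(lra).
  by exists q1; move: q1P; rewrite in_itv.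
have [q2 q2P] : exists q2 : rat, z.2 - d < ratr q2 < z.2 + d.
  have [q2 q2P] := @rat_in_itvoo R (z.2 - d) (z.2 + d) ltac:(lra).
  by exists q2; move: q2P; rewrite in_itv.
exists (pickle (q1, q2, n)) => //; rewrite /q pickleK.
case: asboolP => [_|]; last first.
  case; move=> w [] /=; rewrite !in_itv /= -/d => /andP[? ?] /andP[? ?].
  apply: eU; split => /=; rewrite /ball /= ltr_norml; apply/andP; split; lra.
by rewrite /bx /=; split; rewrite /= in_itv /= -/d; apply/andP; split; lra.
Qed.

Lemma open_measurable_prod U : open U -> measurable U.
Proof.
move=> /open_bigcup_box[q ->]; apply: bigcupT_measurable => i; exact: measurable_box.
Qed.

Lemma closed_measurable_prod U : closed U -> measurable U.
Proof. by move=> /closed_openC/open_measurable_prod/measurableC; rewrite setCK. Qed.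

(** The image is a countable union of compact sets, the images of the boxes. *)
Lemma image_open_measurable (F : R * R -> R * R) U : open U ->
  (forall z, U z -> {for z, continuous F}) -> measurable (F @` U).
Proof.
move=> oU cF; have [q UE] := open_bigcup_box _ oU.
rewrite UE image_bigcup; apply: bigcupT_measurable => i.
apply: closed_measurable_prod; apply: compact_closed.
  exact: norm_hausdorff.
apply: continuous_compact; last exact: compact_box.
apply: continuous_in_subspaceT => z; rewrite inE => zb; apply: cF.
by rewrite UE; exists i.
Qed.

Lemma leb2_xsection A : mu2 A = (\int[mu]_x mu (xsection A x))%E.
Proof. by []. Qed.

Lemma leb2_ysection A : measurable A -> mu2 A = (\int[mu]_y mu (ysection A y))%E.
Proof.
move=> mA; rewrite /leb2.
rewrite (@product_measure_unique _ _ _ _ R mu mu (mu \x^ mu)%E) //.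
by move=> B C mB mC; exact: product_measure2E.
Qed.

Lemma leb2_le A U : measurable A -> measurable U -> A `<=` U -> (mu2 A <= mu2 U)%E.
Proof. by move=> mA mU AU; apply: le_measure => //; rewrite inE. Qed.

Lemma leb2_box a b c d : a <= b -> c <= d ->
  mu2 (box a b c d) = ((b - a) * (d - c))%:E.
Proof.
move=> ab cd; transitivity (mu `[a, b]%classic * mu `[c, d]%classic)%E.
  by apply: product_measure1E; exact: measurable_itv.
have E x y : x <= y -> mu `[x, y]%classic = (y - x)%:E.
  rewrite lebesgue_measure_itv /= lte_fin le_eqVlt => /predU1P[->|->] //.
  by rewrite ltxx subrr.
by rewrite !E.
Qed.

Lemma measurable_shift (s t : R) :
  measurable_fun setT (fun z : R * R => (z.1 + s, z.2 + t)).
Proof.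
apply/measurable_fun_pairP; split.
- by apply: (measurable_funD (f := fst)); [exact: measurable_fst|exact: measurable_cst].
- by apply: (measurable_funD (f := snd)); [exact: measurable_snd|exact: measurable_cst].
Qed.

Lemma measurable_preshift A s t : measurable A ->
  measurable [set z : R * R | A (z.1 + s, z.2 + t)].
Proof. by move=> mA; rewrite -[X in measurable X]setTI; exact: measurable_shift. Qed.

Lemma leb2_translate2_le A t : measurable A ->
  (mu2 [set z | A (z.1, z.2 + t)%R] <= 2%:E * mu2 A)%E.
Proof.
move=> mA; rewrite !leb2_xsection -ge0_integralZl //; last first.
  exact: measurable_fun_xsection.
apply: ge0_le_integral => //.
- apply: measurable_fun_xsection.
  have := measurable_preshift _ 0 t mA; congr (measurable _).
  by apply/funext => z; rewrite /= addr0.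
- by apply: measurable_funeM; exact: measurable_fun_xsection.
move=> x _; apply: le_trans (lebesgue_translate_le _ _ t); apply: lebesgue_outer_le => y.
by rewrite /xsection /= !inE.
Qed.

Lemma leb2_translate1_le A t : measurable A ->
  (mu2 [set z | A (z.1 + t, z.2)%R] <= 2%:E * mu2 A)%E.
Proof.
move=> mA; have mB : measurable [set z | A (z.1 + t, z.2)%R].
  have := measurable_preshift _ t 0 mA; congr (measurable _).
  by apply/funext => z; rewrite /= addr0.
rewrite !leb2_ysection // -ge0_integralZl //; last exact: measurable_fun_ysection.
apply: ge0_le_integral => //.
- exact: measurable_fun_ysection.
- by apply: measurable_funeM; exact: measurable_fun_ysection.
move=> y _; apply: le_trans (lebesgue_translate_le _ _ t); apply: lebesgue_outer_le => x.
by rewrite /ysection /= !inE.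
Qed.

Lemma leb2_null_xsection A : measurable A -> mu2 A = 0%E ->
  {ae mu, forall x, mu (xsection A x) = 0%E}.
Proof.
move=> mA; rewrite leb2_xsection => A0.
have mf : measurable_fun setT (fun x => mu (xsection A x)) by exact: measurable_fun_xsection.
have := ae_eq_integral_abs mu measurableT mf => -[+ _].
move=> H; have {}H : ae_eq mu setT (fun x => mu (xsection A x)) (cst 0%E).
  by apply: H; rewrite -[RHS]A0; apply: eq_integral => x _; rewrite gee0_abs.
by apply: filterS H => x /(_ I).
Qed.

Lemma leb2_null_ysection A : measurable A -> mu2 A = 0%E ->
  {ae mu, forall y, mu (ysection A y) = 0%E}.
Proof.
move=> mA; rewrite leb2_ysection // => A0.
have mf : measurable_fun setT (fun x => mu (ysection A x)) by exact: measurable_fun_ysection.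
have := ae_eq_integral_abs mu measurableT mf => -[+ _].
move=> H; have {}H : ae_eq mu setT (fun x => mu (ysection A x)) (cst 0%E).
  by apply: H; rewrite -[RHS]A0; apply: eq_integral => x _; rewrite gee0_abs.
by apply: filterS H => x /(_ I).
Qed.

(* The contraction [z |-> - i z / 2]. *)
Definition spin (z : R * R) : R * R := (z.2 / 2, - z.1 / 2).

Lemma measurable_spin : measurable_fun setT spin.
Proof.
apply/measurable_fun_pairP; split.
  by apply: measurable_funM; [exact: measurable_snd|exact: measurable_cst].
apply: measurable_funM; last exact: measurable_cst.
exact: (measurable_funN measurable_fst).
Qed.

Lemma ae_affine (P : R -> Prop) (c d : R) : c != 0 ->
  {ae mu, forall x, P x} -> {ae mu, forall x, P (c * x + d)}.
Proof.
move=> c0 [A [mA A0 PA]].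
have := lebesgue_affine_preimage0 _ A c d c0 A0; set B := [set x | A (c * x + d)] => B0.
have /negligible_outer_measure[C [mC C0 BC]] : ((wlength idfun)^*%mu B = 0)%E by exact: B0.
exists C; split => // x Px; apply: BC; rewrite /B /=; apply: PA => /= h; exact: Px.
Qed.

(** A quarter turn exchanges the two families of sections: the vertical section of the preimage at
    [x] is a dilate of the horizontal section of [A] at height [- x / 2], and almost all of the
    latter are null. *)
Lemma leb2_null_spin A : measurable A -> mu2 A = 0%E -> mu2 (spin @^-1` A) = 0%E.
Proof.
move=> mA A0; rewrite leb2_xsection.
have H := leb2_null_ysection _ mA A0.
have c0 : - 2^-1 != 0 :> R by rewrite oppr_eq0 invr_eq0.
have {}H := ae_affine _ _ 0 c0 H.
have c1 : 2^-1 != 0 :> R by rewrite invr_eq0.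
have {}H : {ae mu, forall x, setT x -> mu (xsection (spin @^-1` A) x) = 0%E}.
  apply: ae_mono H => x Hx _.
  rewrite -[RHS](lebesgue_affine_preimage0 _ _ _ 0 c1 Hx); congr (mu _).
  have E y : spin (x, y) = (2^-1 * y + 0, - 2^-1 * x + 0).
    by rewrite /spin /= !addr0 !mulNr ![_ * 2^-1]mulrC.
  by apply/seteqP; split => y; rewrite /xsection /ysection /= !inE /preimage /= E.
rewrite (ae_eq_integral (cst 0%E)) ?integral_cst ?mul0e //.
  apply: measurable_fun_xsection; rewrite -[X in measurable X]setTI; exact: measurable_spin.
Qed.

Lemma ae2_spin (P : R * R -> Prop) :
  {ae mu2, forall z, P z} -> {ae mu2, forall z, P (spin z)}.
Proof.
move=> [A [mA A0 PA]]; exists (spin @^-1` A); split.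
- by rewrite -[X in measurable X]setTI; exact: measurable_spin.
- exact: leb2_null_spin.
- by move=> z Pz; apply: PA => h; exact: Pz.
Qed.

Lemma continuous_measurable_prod (G : R * R -> R) U : open U ->
  (forall z, U z -> {for z, continuous G}) -> measurable_fun U G.
Proof.
move=> oU cG; apply: (measurability (@RGenOInfty.G R)).
  exact: RGenOInfty.measurableE.
move=> _ [_ [a ->] <-]; apply: open_measurable_prod.
rewrite openE => z [Uz Gz]; apply: filterI; first exact: oU.
by apply: (cG _ Uz); apply: open_nbhs_nbhs; split => //; exact: interval_open.
Qed.

(** The exceptional sets lie in the decreasing sets [D m] of points outside [C] that some shift of
    index at least [m] moves into [C]. Their intersection is empty because [C] is closed, and
    boundedness of [C] allows continuity of the measure from above. *)
Lemma leb2_shift_closed (C : set (R * R)) (s t : nat -> R) (e : R) : 0 < e ->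
  closed C -> C `<=` box (-1) 1 (-1) 1 ->
  s @ \oo --> 0 -> t @ \oo --> 0 -> (forall n, `|s n| <= 1) -> (forall n, `|t n| <= 1) ->
  \forall n \near \oo,
    (mu2 [set q | ~ C q /\ C (q.1 - s n, q.2 - t n)%R] <= e%:E)%E.
Proof.
move=> e0 cC Cb s0 t0 s1 t1.
pose B n := [set q | ~ C q /\ C (q.1 - s n, q.2 - t n)].
pose D m := ~` C `&` \bigcup_(k in [set k | (m <= k)%N]) [set q | C (q.1 - s k, q.2 - t k)].
have mC : measurable C by exact: closed_measurable_prod.
have mS k : measurable [set q : R * R | C (q.1 - s k, q.2 - t k)].
  exact: measurable_preshift.
have mD m : measurable (D m).
  by apply: measurableI; [exact: measurableC|apply: bigcup_measurable => k _; exact: mS].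
have mB n : measurable (B n) by apply: measurableI; [exact: measurableC|exact: mS].
have Db : D 0%N `<=` box (-2) 2 (-2) 2.
  move=> q [_ [k _ /Cb [/=]]]; rewrite !in_itv /= => /andP[? ?] /andP[? ?].
  have := s1 k; have := t1 k; rewrite !ler_norml => /andP[? ?] /andP[? ?].
  by split; rewrite /= in_itv /=; apply/andP; split; lra.
have D0 : (mu2 (D 0%N) < +oo)%E.
  apply: le_lt_trans (leb2_le _ _ (mD _) (measurable_box _ _ _ _) Db) _.
  by rewrite leb2_box ?ltry //; lra.
have ndD : nonincreasing_seq D.
  move=> m n mn; apply/subsetPset; apply: setIS; apply: bigcup_subset.
  by move=> k /=; exact: leq_trans.
have capD : \bigcap_n D n = set0.
  rewrite -subset0 => q Dq; have [nCq _] := Dq 0%N I.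
  have := closed_openC cC; rewrite openE => /(_ q nCq)/nbhs_ballP[d /= d0 dC].
  have [N _ NP] : \forall n \near \oo, `|s n| < d /\ `|t n| < d.
    apply: filterI.
      by have /cvgr0Pnorm_lt := s0; apply.
    by have /cvgr0Pnorm_lt := t0; apply.
  have [_ [k /= Nk Ck]] := Dq N I.
  apply: (dC (q.1 - s k, q.2 - t k)) => //; have [? ?] := NP _ Nk.
  by split; rewrite /ball /= opprB addrC subrK.
have := @nonincreasing_cvg_mu _ _ _ mu2 D D0 mD; rewrite capD measure0.
move=> /(_ measurable0 ndD) cv.
have : \forall n \near \oo, (mu2 (D n) < e%:E)%E.
  have e0' : (0 < e%:E :> \bar R)%E by rewrite lte_fin.
  apply: (cv [set x : \bar R | (x < e%:E)%E]); apply: open_nbhs_nbhs.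
  by split => //; exact: open_ereal_lt_ereal.
apply: filterS => n /ltW; apply: le_trans; apply: leb2_le => //; first exact: mB.
by move=> q [nC Cq]; split => //; exists n => /=.
Qed.

Lemma leb2_setU A U : measurable A -> measurable U ->
  (mu2 (A `|` U) <= mu2 A + mu2 U)%E.
Proof. exact: (@measureU2 _ _ _ (mu \x mu)%E). Qed.

(** For the instance that lets [leb2] be a factor of a product measure: squares are counted over
    pairs made of a corner and a point of the image. *)
Lemma leb2_sigma_finite : sigma_finite setT mu2.
Proof.
exists (fun n : nat => box (- n%:R) n%:R (- n%:R) n%:R).
  apply/esym/seteqP; split => // z _; exists (Num.truncn `|z|).+1 => //.
  have := truncnS_gt `|z|; rewrite norm_pair_lt !ltr_norml => /andP[/andP[? ?] /andP[? ?]].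
  by split; rewrite /= in_itv /= !ltW.
move=> n; split; first exact: measurable_box.
by rewrite leb2_box ?ltry // -subr_ge0 opprK addr_ge0.
Qed.

End PlaneMeasure.

HB.instance Definition _ (R : realType) := Measure.on (@leb2 R).
HB.instance Definition _ (R : realType) :=
  @Measure_isSigmaFinite.Build _ _ R (@leb2 R) (@leb2_sigma_finite R).

Arguments box {R}.
Arguments spin {R}.

(** * Counting squares in the image *)

Section DoubleCount.
Context d1 d2 (T1 : measurableType d1) (T2 : measurableType d2) (R : realType).
Variables (m1 : {sigma_finite_measure set T1 -> \bar R})
  (m2 : {sigma_finite_measure set T2 -> \bar R}).

Lemma product_measure_ysection (B : set (T1 * T2)) : measurable B ->
  (m1 \x m2)%E B = (\int[m2]_y m1 (ysection B y))%E.
Proof.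
move=> mB; rewrite (@product_measure_unique _ _ _ _ R m1 m2 (m1 \x^ m2)%E) //.
by move=> X Y mX mY; exact: product_measure2E.
Qed.

(* Both sides estimate the measure of the union of the [T i] in the product. *)
Lemma tonelli_double_count (A : nat -> set T1) (T : nat -> set (T1 * T2))
    (c : nat -> R) (V : set T2) (K : R) :
  (forall i, measurable (A i)) -> (forall i, measurable (T i)) -> measurable V ->
  trivIset setT T -> (forall i, 0 <= c i) -> 0 <= K ->
  (forall i p, A i p -> m2 (xsection (T i) p) = (c i)%:E) ->
  (forall i p w, ~ A i p -> ~ T i (p, w)) ->
  (forall w, V w -> (m1 (ysection (\bigcup_i T i) w) <= K%:E)%E) ->
  (forall i p w, ~ V w -> ~ T i (p, w)) ->
  (\sum_(i <oo) (c i)%:E * m1 (A i) <= K%:E * m2 V)%E.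
Proof.
move=> mA mT mV tT c0 K0 cA nA KV nV.
have mUT : measurable (\bigcup_i T i) by exact: bigcupT_measurable.
have MT i : (m1 \x m2)%E (T i) = ((c i)%:E * m1 (A i))%E.
  rewrite /product_measure1 (eq_integral (fun p => (c i)%:E * (\1_(A i) p)%:E)%E); last first.
    move=> p _; rewrite indicE; case: (boolP (p \in A i)) => Ap.
      by rewrite mule1 /= cA //; rewrite inE in Ap.
    rewrite mule0 -[RHS](measure0 m2) /=; congr (m2 _).
    rewrite -subset0 => w; rewrite /xsection /= inE; apply: nA => Ap'.
    by move/negP: Ap; apply; rewrite inE.
  rewrite ge0_integralZl //.
  - by rewrite integral_indic // setIT.
  - exact: measurableT_comp.
  - by rewrite lee_fin.
rewrite (eq_eseriesr (fun i _ => esym (MT i))).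
have -> : (\sum_(i <oo) (m1 \x m2) (T i))%E = (m1 \x m2)%E (\bigcup_i T i).
  exact/esym/measure_semi_bigcup.
rewrite product_measure_ysection //.
have -> : m2 V = (\int[m2]_w (\1_V w)%:E)%E by rewrite integral_indic // setIT.
rewrite -ge0_integralZl //; last exact: measurableT_comp.
apply: ge0_le_integral => //.
- exact: measurable_fun_ysection.
- by apply: measurable_funeM; exact: measurableT_comp.
move=> w _; rewrite indicE; case: (boolP (w \in V)) => Fw.
  by rewrite mule1; apply: KV; rewrite inE in Fw.
rewrite mule0 (_ : ysection _ _ = set0) ?measure0 //.
rewrite -subset0 => p; rewrite /ysection /= inE => -[i _]; apply: nV => Vw.
by move/negP: Fw; apply; rewrite inE.
Qed.

End DoubleCount.

Section DisjointSquares.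
Variable R : realType.
Local Notation mu2 := (@leb2 R).
Variables (F : R * R -> R * R) (U : set (R * R)) (k h : R).
Hypothesis oU : open U.
Hypothesis cF : forall z, U z -> {for z, continuous F}.
Hypothesis iF : forall z w, U z -> U w -> F z = F w -> z = w.
Hypothesis k0 : 0 < k.
Hypothesis h0 : 0 < h.

Lemma measurable_near_image (A : set (R * R)) (v : R * R) (r : R) :
  measurable A -> A `<=` U ->
  measurable [set x : (R * R) * (R * R) | A x.1 /\ `|x.2 - (F x.1 + v)| < r].
Proof.
move=> mA AU; pose D : set ((R * R) * (R * R)) := A `*` setT.
have mD : measurable D by apply: measurableX.
have mG (G : R * R -> R) : (forall z, U z -> {for z, continuous G}) ->
    measurable_fun D (G \o fst).
  move=> cG; apply: (@measurable_comp _ _ _ _ _ _ A) => //.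
  - by move=> _ [x [Ax _] <-].
  - apply: (@measurable_funS _ _ _ _ U) => //; first exact: open_measurable_prod.
    exact: continuous_measurable_prod.
  - by apply: measurable_funS measurable_fst.
have m1 : measurable_fun D (fun x : (R * R) * (R * R) => x.2.1 - ((F x.1).1 + v.1)).
  apply: measurable_funB.
    apply: measurable_funS measurableT _ _ => //.
    exact: (measurableT_comp measurable_fst measurable_snd).
  apply: measurable_funD; last exact: measurable_cst.
  apply: (mG (fst \o F)) => z Uz.
  by apply: (cvg_comp F fst (cF _ Uz)); exact: cvg_fst.
have m2 : measurable_fun D (fun x : (R * R) * (R * R) => x.2.2 - ((F x.1).2 + v.2)).
  apply: measurable_funB.
    apply: measurable_funS measurableT _ _ => //.
    exact: (measurableT_comp measurable_snd measurable_snd).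
  apply: measurable_funD; last exact: measurable_cst.
  apply: (mG (snd \o F)) => z Uz.
  by apply: (cvg_comp F snd (cF _ Uz)); exact: cvg_snd.
have mI : measurable (`]-r, r[%classic : set R) by exact: measurable_itv.
have := measurableI _ _ (m1 mD _ mI) (m2 mD _ mI); congr (measurable _).
apply/seteqP; split => x /=.
  rewrite !in_itv /= => -[[[Ax _] i1] [_ i2]]; split => //.
  by rewrite norm_pair_lt !ltr_norml /= i1 i2.
rewrite norm_pair_lt !ltr_norml /= => -[Ax /andP[i1 i2]].
by split; split => //; rewrite in_itv.
Qed.

(** The norm of a pair is the maximum norm, so the ball is a square of side [2 * r]. *)
Lemma leb2_ball (c : R * R) (r : R) : 0 <= r ->
  mu2 [set w : R * R | `|w - c| < r] = ((2 * r) ^+ 2)%:E.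
Proof.
move=> r0.
have -> : [set w : R * R | `|w - c| < r] =
    `]c.1 - r, c.1 + r[%classic `*` `]c.2 - r, c.2 + r[%classic.
  apply/seteqP; split => w /=; rewrite norm_pair_lt !ltr_norml /= !in_itv /=.
    by move=> /andP[/andP[? ?] /andP[? ?]]; split; apply/andP; split; lra.
  by move=> [/andP[? ?] /andP[? ?]]; apply/andP; split; apply/andP; split; lra.
have E x : (@lebesgue_measure R) `]x - r, x + r[%classic = (2 * r)%:E.
  rewrite lebesgue_measure_itv /= lte_fin; case: ltP => h1; first by rewrite -EFinB; congr EFin; lra.
  by congr EFin; lra.
transitivity ((@lebesgue_measure R) `](c.1 - r)%R, (c.1 + r)%R[%classic *
   (@lebesgue_measure R) `](c.2 - r)%R, (c.2 + r)%R[%classic)%E.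
  by apply: product_measure1E; exact: measurable_itv.
by rewrite !E -EFinM expr2.
Qed.

(** The squares attached to different corners may overlap. However, a point [F z] can lie only in
    squares whose corner is in the box of sides [k * h] and [h] with upper right vertex [z], since
    [F] is injective. Hence its multiplicity, measured over the corners, is at most [k * h * h]. *)
Lemma disjoint_squares_area (A : nat -> set (R * R)) (v : nat -> R * R) (r : nat -> R) :
  (forall i, measurable (A i)) -> trivIset setT A -> (forall i, A i `<=` U) ->
  (forall i, 0 <= r i) ->
  (forall i p w, A i p -> `|w - (F p + v i)| < r i ->
    exists z, [/\ U z, F z = w, p.1 <= z.1 <= p.1 + k * h & p.2 <= z.2 <= p.2 + h]) ->
  (\sum_(i <oo) ((2 * r i) ^+ 2)%:E * mu2 (A i) <= (k * h * h)%:E * mu2 (F @` U))%E.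
Proof.
move=> mA tA AU r0 sq.
pose T i := [set x : (R * R) * (R * R) | A i x.1 /\ `|x.2 - (F x.1 + v i)| < r i].
have mT i : measurable (T i) by exact: measurable_near_image.
have mUT : measurable (\bigcup_i T i) by exact: bigcupT_measurable.
have tT : trivIset setT T.
  move=> i j _ _ [x [[Ai _] [Aj _]]]; apply: tA => //; by exists x.1.
have mFU : measurable (F @` U) by exact: image_open_measurable.
apply: (@tonelli_double_count _ _ _ _ R (@leb2 R) (@leb2 R) A T
  (fun i => (2 * r i) ^+ 2) (F @` U)) => //.
- by move=> i; exact: sqr_ge0.
- by rewrite !mulr_ge0 // ltW.
- move=> i p Ap; rewrite -(leb2_ball (F p + v i)) //; congr (mu2 _).
  apply/seteqP; split => w; rewrite /xsection /T /= !inE /=; first by case.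
  by move=> ?; split.
- by move=> i p w Ap; rewrite /T /= => -[/Ap].
- move=> w [z Uz zw].
  have -> : (k * h * h)%:E = mu2 (box (z.1 - k * h) z.1 (z.2 - h) z.2).
    rewrite leb2_box ?gerBl ?mulr_ge0 ?ltW //.
    by rewrite !opprB ![_ + (_ - _)]addrC !subrK.
  apply: leb2_le; [exact: measurable_ysection|exact: measurable_box|].
  move=> p; rewrite /ysection /= inE => -[i _ [Ap wp]].
  have [z' [Uz' z'w z1 z2]] := sq _ _ _ Ap wp.
  have E : z' = z by apply: iF => //; rewrite z'w.
  by move: z1 z2; rewrite E => /andP[? ?] /andP[? ?]; split; rewrite /= in_itv /=; apply/andP; split; lra.
- move=> i p w Fw [Ap wp]; apply: Fw.
  by have [z [Uz zw _ _]] := sq _ _ _ Ap wp; exists z.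
Qed.

End DisjointSquares.

(** * Area bound for the squared slopes *)

Section DerivableApprox.
Variable R : realType.

Lemma derivable_approx (F : R * R -> R * R) (p v : R * R) (e : R) : 0 < e ->
  derivable F p v ->
  exists2 d : R, 0 < d & forall t : R, `|t| <= d ->
    `|F (t *: v + p) - F p - t *: 'D_v F p| <= e * `|t|.
Proof.
move=> e0 dF.
have : (fun t : R => t^-1 *: ((F \o shift p) (t *: v) - F p)) @ 0^' --> 'D_v F p by [].
move=> /cvgrPdist_le /(_ _ e0) /nbhs_ballP[d /= d0 H].
exists (d / 2); first by rewrite divr_gt0.
move=> t td; have [->|t0] := eqVneq t 0.
  by rewrite !scale0r add0r subrr subr0 !normr0 mulr0.
have {H} := H t; rewrite /ball /= sub0r normrN => H.
have {H} := H ltac:(lra) t0.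
rewrite distrC -(ler_pM2r (_ : 0 < `|t|)) ?normr_gt0 // mulrC -normrZ.
by rewrite scalerBr scalerA divff // scale1r.
Qed.

End DerivableApprox.

Section Pieces.
Variable R : realType.
Local Notation mu2 := (@leb2 R).
Variables (F : R * R -> R * R) (U : set (R * R)) (k tau : R).
Hypothesis oU : open U.
Hypothesis cF : forall z, U z -> {for z, continuous F}.
Hypothesis iF : forall z w, U z -> U w -> F z = F w -> z = w.
Hypothesis Ub : U `<=` box (-1) 1 (-1) 1.
Hypothesis k0 : 0 < k.
Hypothesis k1 : k <= 1.
Hypothesis tau0 : 0 < tau.

(** The radius is twice [1 / n.+1] so that displacements up to and including [1 / n.+1] in each
    coordinate stay in [U]. *)
Definition core (n : nat) : set (R * R) := [set p | ball p (2 / n.+1%:R) `<=` U].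

Lemma core_shift n p s t : core n p -> `|s| <= n.+1%:R^-1 -> `|t| <= n.+1%:R^-1 ->
  U (p.1 + s, p.2 + t).
Proof.
move=> cp hs ht; apply: cp.
have n0 : 0 < n.+1%:R^-1 :> R by rewrite invr_gt0 ltr0n.
move: hs ht n0; set d := n.+1%:R^-1 => hs ht d0.
by split; rewrite /ball /= opprD addrA subrr sub0r normrN; lra.
Qed.

Lemma core_sub n : core n `<=` U.
Proof. by move=> p; apply; apply: ballxx; rewrite divr_gt0. Qed.

Lemma closed_core n : closed (core n).
Proof.
rewrite -[core n]setCK; apply: open_closedC.
have -> : ~` core n = \bigcup_(q in ~` U) ball q (2 / n.+1%:R).
  apply/seteqP; split => [p /= /existsNP[q /not_implyP[bq nUq]]|p [q nUq bq] cp].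
    by exists q => //; apply: ball_sym.
  by apply: nUq; apply: cp; apply: ball_sym.
by apply: bigcup_open => q _; apply: ball_open; rewrite divr_gt0.
Qed.

(** The index type is arbitrary: conditions over all real [t] still define a closed set, so the
    pieces below are measurable without any study of the derivatives as functions. *)
Lemma closed_core_le n (I : Type) (D : set I) (G : I -> R * R -> R) (c : I -> R) :
  (forall i, D i -> forall p, core n p -> {for p, continuous (G i)}) ->
  closed [set p | core n p /\ forall i, D i -> G i p <= c i].
Proof.
move=> cG p clp.
have cp : core n p.
  by apply: closed_core => B /clp[q [[cq _] Bq]]; exists q.
split => // i Di; rewrite leNgt; apply/negP => lt.
have : nbhs p [set q | c i < G i q].
  apply: (cG i Di p cp [set y | c i < y]).
  by apply: open_nbhs_nbhs; split => //; exact: open_gt.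
move=> /clp[q [[_ /(_ i Di)]]] /=; by rewrite leNgt => /negP.
Qed.

Lemma continuous_shifted p s t : U (p.1 + s, p.2 + t) ->
  {for p, continuous (fun q => F (q.1 + s, q.2 + t))}.
Proof.
move=> Up; apply: (@continuous_comp _ _ _ (fun q : R * R => (q.1 + s, q.2 + t)) F).
  have h1 : (fun q : R * R => q.1 + s) @ p --> p.1 + s.
    by apply: cvgD; [exact: cvg_fst|exact: cvg_cst].
  have h2 : (fun q : R * R => q.2 + t) @ p --> p.2 + t.
    by apply: cvgD; [exact: cvg_snd|exact: cvg_cst].
  exact: (cvg_pair h1 h2).
exact: cF.
Qed.

(* [a] stands for the vertical derivative, hence [mulNi a] for [k] times the horizontal one. *)
Definition linear_piece (a : R * R) (n : nat) : set (R * R) := [set p | core n p /\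
  forall t : R, `|t| <= n.+1%:R^-1 ->
    `|F (p.1, p.2 + t) - F p - t *: a| <= `|a| * `|t| / 16 /\
    `|F (p.1 + k * t, p.2) - F p - t *: mulNi a| <= `|a| * `|t| / 16].

(** Serves the points where the vertical derivative vanishes and [square_in_image] has no direction
    to work with. They count with slope 0 in the area and with the small constant [tau] in the
    length. *)
Definition flat_piece (n : nat) : set (R * R) := [set p | core n p /\
  forall t : R, `|t| <= n.+1%:R^-1 -> `|F (p.1, p.2 + t) - F p| <= 2 * tau * `|t|].

Lemma kt_le n t : `|t| <= n.+1%:R^-1 -> `|k * t| <= n.+1%:R^-1 :> R.
Proof.
move=> tn; rewrite normrM gtr0_norm //; apply: le_trans tn.
by rewrite ler_piMl.
Qed.

Lemma continuous_diff p (s t : R) v : U p -> U (p.1 + s, p.2 + t) ->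
  {for p, continuous (fun q => `|F (q.1 + s, q.2 + t) - F q - v|)}.
Proof.
move=> Up Up'; apply: cvg_norm; apply: cvgB; last exact: cvg_cst.
by apply: cvgB; [exact: continuous_shifted|exact: cF].
Qed.

Lemma closed_linear_piece a n : closed (linear_piece a n).
Proof.
have -> : linear_piece a n = [set p | core n p /\ forall i : bool * R,
    `|i.2| <= n.+1%:R^-1 ->
    (if i.1 then `|F (p.1 + 0, p.2 + i.2) - F p - i.2 *: a|
     else `|F (p.1 + k * i.2, p.2 + 0) - F p - i.2 *: mulNi a|) <= `|a| * `|i.2| / 16].
  apply/seteqP; split => p [cp H]; split => //.
    by move=> [[] t] /= /H[]; rewrite addr0.
  by move=> t tn; have := H (true, t) tn; have := H (false, t) tn; rewrite /= !addr0.
apply: (@closed_core_le n _ [set i : bool * R | `|i.2| <= n.+1%:R^-1]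
   (fun i p => if i.1 then `|F (p.1 + 0, p.2 + i.2) - F p - i.2 *: a|
     else `|F (p.1 + k * i.2, p.2 + 0) - F p - i.2 *: mulNi a|)
   (fun i => `|a| * `|i.2| / 16)).
have n0 : `|0 : R| <= n.+1%:R^-1 by rewrite normr0 invr_ge0.
move=> [[] t] /= tn p cp; apply: continuous_diff; try exact: core_sub cp.
  exact: (core_shift _ _ _ _ cp n0 tn).
exact: (core_shift _ _ _ _ cp (kt_le _ _ tn) n0).
Qed.

Lemma closed_flat_piece n : closed (flat_piece n).
Proof.
have -> : flat_piece n = [set p | core n p /\ forall t : R, `|t| <= n.+1%:R^-1 ->
    `|F (p.1 + 0, p.2 + t) - F p - 0| <= 2 * tau * `|t|].
  by apply/seteqP; split => p [cp H]; split => // t /H; rewrite addr0 subr0.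
apply: (@closed_core_le n _ [set t : R | `|t| <= n.+1%:R^-1]
   (fun t p => `|F (p.1 + 0, p.2 + t) - F p - 0|) (fun t => 2 * tau * `|t|)).
have n0 : `|0 : R| <= n.+1%:R^-1 by rewrite normr0 invr_ge0.
move=> t /= tn p cp; apply: continuous_diff; first exact: core_sub cp.
exact: (core_shift _ _ _ _ cp n0 tn).
Qed.

Definition ratpt (q : rat * rat) : R * R := (ratr q.1, ratr q.2).

Definition piece_code (i : nat) : option (option (rat * rat) * nat) := unpickle i.

(** Countably many pieces, enumerated through codes: a rational vector and a scale for a linear
    piece, a scale alone for a flat one. Codes with a zero vector give the empty set. *)
Definition piece (i : nat) : set (R * R) :=
  match piece_code i with
  | Some (Some q, n) => if ratpt q == 0 then set0 else linear_piece (ratpt q) n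
  | Some (None, n) => flat_piece n
  | None => set0
  end.

Definition slope (i : nat) : R :=
  if piece_code i is Some (Some q, _) then `|ratpt q| else 0.

Lemma slope_ge0 i : 0 <= slope i.
Proof. by rewrite /slope; case: (piece_code i) => [[[q|] n]|]. Qed.

Lemma closed_piece i : closed (piece i).
Proof.
rewrite /piece; case: (piece_code i) => [[[q|] n]|]; last exact: closed0.
  by case: ifP => _; [exact: closed0|exact: closed_linear_piece].
exact: closed_flat_piece.
Qed.

Lemma piece_sub i : piece i `<=` U.
Proof.
rewrite /piece; case: (piece_code i) => [[[q|] n]|] //; last first.
  by move=> p [/core_sub].
by case: ifP => [_ p []|_ p [/core_sub]].
Qed.

Lemma measurable_piece i : measurable (piece i).
Proof. by apply: closed_measurable_prod; exact: closed_piece. Qed.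

Lemma piece_lipschitz i : exists2 d : R, 0 < d & forall p t, piece i p -> `|t| <= d ->
  `|F (p.1, p.2 + t) - F p| <= (2 * slope i + 2 * tau) * `|t|.
Proof.
rewrite /piece /slope; case: (piece_code i) => [[[q|] n]|]; last by exists 1.
  case: ifP => _; first by exists 1.
  exists n.+1%:R^-1; first by rewrite invr_gt0 ltr0n.
  move=> p t [_ H] /H[h _]; set a := ratpt q in h *.
  have := ler_normD (F (p.1, p.2 + t) - F p - t *: a) (t *: a); rewrite subrK normrZ.
  move: (normr_ge0 a) (normr_ge0 t) => ? ? h'; apply: (le_trans h').
  by have := tau0; nra.
exists n.+1%:R^-1; first by rewrite invr_gt0 ltr0n.
by move=> p t [_ H] /H; rewrite mulr0 add0r.
Qed.

(** Partial derivatives suffice: the pieces compare [F] only along the two axes through the point,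
    and the hypothesis on the derivatives makes both comparisons use the same vector [a]. *)
Lemma piece_cover p : U p -> derivable F p (1, 0) -> derivable F p (0, 1) ->
  'D_((1, 0) : R * R) F p = k^-1 *: mulNi ('D_((0, 1) : R * R) F p) ->
  exists i, piece i p.
Proof.
move=> Up d1 d2 E; set a0 := 'D_((0, 1) : R * R) F p in E.
have /nbhs_ballP[e /= e0 eU] := oU _ Up.
have nex (d : R) : 0 < d -> exists n : nat, n.+1%:R^-1 <= d.
  move=> d0; exists (Num.truncn d^-1); rewrite -[leRHS]invrK lef_pV2 ?posrE ?invr_gt0 ?ltr0n //.
  by rewrite ltW // truncnS_gt.
have coreP n : n.+1%:R^-1 <= e / 2 -> core n p.
  move=> ne q bq; apply: eU; apply: le_ball bq; move: ne; set d0 := n.+1%:R^-1; lra.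
have s2 (t : R) : t *: (0, 1) + p = (p.1, p.2 + t) :> R * R.
  by rewrite [LHS]surjective_pairing /= /GRing.scale /= mulr0 mulr1 add0r addrC.
have s1 (t : R) : t *: (1, 0) + p = (p.1 + t, p.2) :> R * R.
  by rewrite [LHS]surjective_pairing /= /GRing.scale /= mulr0 mulr1 add0r addrC.
have [a00|a00] := eqVneq a0 0.
  have [d d0 H] := derivable_approx _ _ _ _ _ tau0 d2.
  have [n nP] := nex (Num.min d (e / 2)) ltac:(by rewrite lt_min d0 divr_gt0).
  move: nP; rewrite le_min => /andP[nd ne].
  exists (pickle (None : option (rat * rat), n)); rewrite /piece /piece_code pickleK.
  split; first exact: coreP.
  move=> t tn; have := H t (le_trans tn nd).
  rewrite -/a0 a00 scaler0 subr0 s2 => /le_trans; apply.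
  by have := normr_ge0 t; have := tau0; nra.
have na0 : 0 < `|a0| by rewrite normr_gt0.
(* One [eps] is spent on differentiability and one on the rational approximation; the total
   [|a0| / 32] is below [|a| / 16] because [|a|] is at least [63 / 64 * |a0|]. *)
pose eps := `|a0| / 64; have eps0 : 0 < eps by rewrite divr_gt0.
have [d d0 H] := derivable_approx _ _ _ _ _ eps0 d2.
have [d' d'0 H'] := derivable_approx _ _ _ _ _ eps0 d1.
have [q1 q1P] : exists q : rat, a0.1 - eps < ratr q < a0.1 + eps.
  have [q1 q1P] := @rat_in_itvoo R (a0.1 - eps) (a0.1 + eps) ltac:(lra).
  by exists q1; move: q1P; rewrite in_itv.
have [q2 q2P] : exists q : rat, a0.2 - eps < ratr q < a0.2 + eps.
  have [q2 q2P] := @rat_in_itvoo R (a0.2 - eps) (a0.2 + eps) ltac:(lra).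
  by exists q2; move: q2P; rewrite in_itv.
pose a := ratpt (q1, q2).
have aa0 : `|a0 - a| <= eps.
  rewrite norm_pair_le !ler_norml /=.
  by move: q1P q2P => /andP[? ?] /andP[? ?]; apply/andP; split; apply/andP; split; lra.
have na : `|a0| - eps <= `|a|.
  have := ler_normD (a0 - a) a; rewrite subrK; lra.
have a_neq0 : a != 0 by rewrite -normr_gt0; apply: lt_le_trans na; rewrite /eps; lra.
have [n nP] := nex (Num.min (Num.min d d') (e / 2))
  ltac:(by rewrite !lt_min d0 d'0 divr_gt0).
move: nP; rewrite !le_min => /andP[/andP[nd nd'] ne].
exists (pickle (Some (q1, q2), n)); rewrite /piece /piece_code pickleK.
rewrite -/a (negbTE a_neq0); split; first exact: coreP.
move=> t tn; split.
  have := H t (le_trans tn nd); rewrite -/a0 s2; set X := _ - F p => h.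
  have -> : X - t *: a = (X - t *: a0) + t *: (a0 - a).
    by rewrite scalerBr addrA subrK.
  apply: le_trans (ler_normD _ _) _; rewrite normrZ.
  move: (normr_ge0 t) => t0.
  have : `|t| * `|a0 - a| <= `|t| * eps by rewrite ler_wpM2l.
  by rewrite /eps in h na *; nra.
have := H' (k * t) (le_trans (kt_le _ _ tn) nd'); rewrite E s1 scalerA mulrAC divff ?gt_eqF // mul1r.
set X := _ - F p => h.
have -> : X - t *: mulNi a = (X - t *: mulNi a0) + t *: mulNi (a0 - a).
  by rewrite mulNiB scalerBr addrA subrK.
apply: le_trans (ler_normD _ _) _; rewrite normrZ norm_mulNi.
move: (normr_ge0 t) => t0.
have : `|t| * `|a0 - a| <= `|t| * eps by rewrite ler_wpM2l.
have kt : `|k * t| <= `|t| by rewrite normrM gtr0_norm // ler_piMl.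
have : eps * `|k * t| <= eps * `|t| by rewrite ler_wpM2l // ltW.
by rewrite /eps in h na *; nra.
Qed.

Local Notation E := (seqDU piece).

(* The vertices [p], [p + (k h, 0)], [p + (0, h)] lie in the piece, so that all four edges of the
   rectangle are under control. *)
Definition good_corner (m i : nat) : set (R * R) :=
  if piece_code i is Some (Some q, n) then
    if (ratpt q != 0) && (n <= m)%N then
      E i `&` ([set p | piece i (p.1 + k * m.+1%:R^-1, p.2 + 0)] `&`
               [set p | piece i (p.1 + 0, p.2 + m.+1%:R^-1)])
    else set0
  else set0.

Lemma measurable_seqDU_piece i : measurable (E i).
Proof.
rewrite /seqDU; apply: measurableD; first exact: measurable_piece.
by apply: bigsetU_measurable => j _; exact: measurable_piece.
Qed.

Lemma measurable_good_corner m i : measurable (good_corner m i).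
Proof.
rewrite /good_corner; case: (piece_code i) => [[[q|] n]|] //; case: ifP => // _.
apply: measurableI; first exact: measurable_seqDU_piece.
by apply: measurableI; apply: measurable_preshift; exact: measurable_piece.
Qed.

Lemma good_corner_sub m i : good_corner m i `<=` E i.
Proof.
by rewrite /good_corner; case: (piece_code i) => [[[q|] n]|] //; case: ifP => // _ p [].
Qed.

Lemma seqDU_piece_sub i : E i `<=` U.
Proof. by move=> p [/piece_sub]. Qed.

Definition center (m i : nat) : R * R :=
  if piece_code i is Some (Some q, n) then
    (m.+1%:R^-1 / 2) *: (ratpt q + mulNi (ratpt q)) else 0.

Lemma good_corner_square m i p w : good_corner m i p ->
  `|w - (F p + center m i)| < slope i * m.+1%:R^-1 / 16 ->
  exists z, [/\ U z, F z = w, p.1 <= z.1 <= p.1 + k * m.+1%:R^-1 &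
    p.2 <= z.2 <= p.2 + m.+1%:R^-1].
Proof.
rewrite /good_corner /center /slope.
case Ei : (piece_code i) => [[[q|] n]|] //; case: ifP => // /andP[q0 nm].
have pE : piece i = linear_piece (ratpt q) n by rewrite /piece Ei (negbTE q0).
rewrite pE; set a := ratpt q in q0 *; set h := m.+1%:R^-1.
have h0 : 0 < h by rewrite invr_gt0 ltr0n.
have hn : h <= n.+1%:R^-1 by rewrite lef_pV2 ?posrE ?ltr0n // ler_nat.
rewrite /= !addr0 => -[[+ _] [[_ Pr] [_ Pt]]].
rewrite pE => -[cp Pp] /ltW wP.
have UQ z : p.1 <= z.1 <= p.1 + k * h -> p.2 <= z.2 <= p.2 + h -> U z.
  move=> /andP[z1 z1'] /andP[z2 z2'].
  have kh : k * h <= h by rewrite ler_piMl // ltW.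
  have -> : z = (p.1 + (z.1 - p.1), p.2 + (z.2 - p.2)).
    by rewrite ![_ + (_ - _)]addrC !subrK -surjective_pairing.
  by apply: (core_shift n) => //; rewrite ger0_norm ?subr_ge0 //; apply: le_trans hn; lra.
have tn t : 0 <= t <= h -> `|t| <= n.+1%:R^-1 /\ `|a| * `|t| / 16 <= `|a| * h / 16.
  move=> /andP[t0 th]; rewrite ger0_norm //; split; first exact: le_trans th hn.
  by rewrite ler_pM2r // ler_wpM2l.
have [|||||z [z1 z2 zw]] := @square_in_image R F p a h k h0 k0 q0 _ _ _ _ _ w wP.
- by move=> z z1 z2; apply: cF; exact: UQ.
- by move=> t /tn[tn' th]; apply: le_trans th; have [] := Pp t tn'.
- by move=> t /tn[tn' th]; apply: le_trans th; have [] := Pp t tn'.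
- by move=> t /tn[tn' th]; apply: le_trans th; have [] := Pr t tn'.
- by move=> t /tn[tn' th]; apply: le_trans th; have [] := Pt t tn'.
by exists z; split => //; exact: UQ.
Qed.

(** A square of half-side [slope i * h / 16] has area [slope i ^ 2 * h ^ 2 / 64], and each image
    point is covered with multiplicity at most [k * h ^ 2]. The mesh [h] cancels, leaving a bound
    uniform in [m]. *)
Lemma slope_good_corner m N :
  (\sum_(i < N) ((slope i) ^+ 2)%:E * mu2 (good_corner m i) <= (64 * k)%:E * mu2 (F @` U))%E.
Proof.
set h : R := m.+1%:R^-1.
have h0 : 0 < h by rewrite invr_gt0 ltr0n.
have := @disjoint_squares_area R F U k h oU cF iF k0 h0 (good_corner m) (center m)
   (fun i => slope i * h / 16).
move=> /(_ (measurable_good_corner m)) H.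
have {}H := H ltac:(move=> i j _ _ [p [gi gj]]; apply: (@trivIset_seqDU _ piece) => //;
  by exists p; split; [exact: good_corner_sub gi|exact: good_corner_sub gj]).
have {}H := H (fun i => subset_trans (@good_corner_sub m i) (@seqDU_piece_sub i)).
have {}H := H ltac:(by move=> i; rewrite divr_ge0 // mulr_ge0 // ?slope_ge0 // ltW).
have {}H := H (good_corner_square m).
have c0 : (0 < 64 / h ^+ 2)%R by rewrite divr_gt0 // exprn_gt0.
have hN0 : h != 0 by rewrite gt_eqF.
have eq1 (x y : R) : y != 0 -> 64 * x = 64 / y ^+ 2 * (x * y * y) by move=> y0; field.
have eq2 (x y : R) : y != 0 -> 64 / y ^+ 2 * (2 * (x * y / 16)) ^+ 2 = x ^+ 2 by move=> y0; field.
have -> : ((64 * k)%:E * mu2 (F @` U))%E = ((64 / h ^+ 2)%:E * ((k * h * h)%:E * mu2 (F @` U)))%E.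
  rewrite muleA -EFinM; congr (_%:E * _)%E.
  exact: eq1.
apply: (@le_trans _ _ ((64 / h ^+ 2)%:E *
  (\sum_(0 <= i < N) (((2 * (slope i * h / 16)) ^+ 2)%:E * mu2 (good_corner m i))))%E); last first.
  rewrite lee_pmul2l ?lte_fin //; apply: le_trans H; apply: nneseries_lim_ge => i _ _.
  by rewrite mule_ge0 // lee_fin sqr_ge0.
rewrite big_mkord ge0_sume_distrr; last by move=> i _; rewrite mule_ge0 // lee_fin sqr_ge0.
apply: lee_sum => i _; rewrite muleA -EFinM.
rewrite (_ : 64 / h ^+ 2 * (2 * (slope i * h / 16)) ^+ 2 = slope i ^+ 2) //.
exact: eq2.
Qed.

(** A point of the piece fails to be a good corner at a fine mesh only if one of its two
    neighbouring vertices leaves the piece. Translated to that vertex, such points form the small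
    sets of [leb2_shift_closed]. *)
Lemma good_corner_approx i e : 0 < e -> \forall m \near \oo,
  (((slope i) ^+ 2)%:E * mu2 (E i) <= ((slope i) ^+ 2)%:E * mu2 (good_corner m i) + e%:E)%E.
Proof.
move=> e0.
have [s0|sN0] := eqVneq (slope i) 0.
  by apply: nearW => m; rewrite s0 expr0n /= !mul0e add0e lee_fin ltW.
have s0 : 0 < slope i ^+ 2 by rewrite exprn_even_gt0.
have [q [n Ei]] : exists q n, piece_code i = Some (Some q, n).
  by move: sN0; rewrite /slope; case: (piece_code i) => [[[q|] n]|]; rewrite ?eqxx // => _; exists q, n.
have q0 : ratpt q != 0 by move: sN0; rewrite /slope Ei normr_eq0.
(* Two vertices may fail, and translating each exceptional set back costs a factor 2, so [4 * d] is
   lost in all. *)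
pose d := e / (4 * slope i ^+ 2).
have d0 : 0 < d by rewrite divr_gt0 // mulr_gt0.
pose s (m : nat) : R := m.+1%:R^-1.
have s_cvg : s @ \oo --> 0 by exact: cvg_harmonic.
have s1 m : `|s m| <= 1.
  by rewrite /s ger0_norm ?invr_ge0 // invf_le1 ?ltr0n // ler1n.
have ks_cvg : (fun m => k * s m) @ \oo --> 0.
  by rewrite -(mulr0 k); apply: cvgM => //; exact: cvg_cst.
have ks1 m : `|k * s m| <= 1.
  by rewrite normrM (gtr0_norm k0) mulr_ile1 // ltW.
have z1 (m : nat) : `|0 : R| <= 1 by rewrite normr0.
have z_cvg : (fun _ : nat => 0 : R) @ \oo --> (0 : R) by exact: cvg_cst.
have Cb : piece i `<=` box (-1) 1 (-1) 1 by move=> p /piece_sub; exact: Ub.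
have H1 := @leb2_shift_closed R (piece i) _ _ d d0 (closed_piece i) Cb ks_cvg z_cvg ks1 z1.
have H2 := @leb2_shift_closed R (piece i) _ _ d d0 (closed_piece i) Cb z_cvg s_cvg z1 s1.
case: H1 => N1 _ H1; case: H2 => N2 _ H2.
exists (maxn n (maxn N1 N2)) => // m /=; rewrite !geq_max => /andP[nm /andP[m1 m2]].
have h1 := H1 _ m1; have h2 := H2 _ m2.
have mP := measurable_piece i.
pose B1 := [set q : R * R | ~ piece i q /\ piece i (q.1 - k * s m, q.2 - 0)].
pose B2 := [set q : R * R | ~ piece i q /\ piece i (q.1 - 0, q.2 - s m)].
have mB1 : measurable B1.
  by apply: measurableI; [exact: measurableC|exact: measurable_preshift].
have mB2 : measurable B2.
  by apply: measurableI; [exact: measurableC|exact: measurable_preshift].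
pose A1 := [set p : R * R | B1 (p.1 + k * s m, p.2)].
pose A2 := [set p : R * R | B2 (p.1, p.2 + s m)].
have mA1 : measurable A1.
  by have := measurable_preshift _ _ (k * s m) 0 mB1; congr (measurable _); apply/funext => p /=; rewrite addr0.
have mA2 : measurable A2.
  by have := measurable_preshift _ _ 0 (s m) mB2; congr (measurable _); apply/funext => p /=; rewrite addr0.
have sub : E i `<=` good_corner m i `|` (A1 `|` A2).
  move=> p Ep; have pp : piece i p by case: Ep.
  rewrite /good_corner Ei q0 nm /=.
  have [c1|c1] := pselect (piece i (p.1 + k * s m, p.2)); last first.
    by right; left; split => //=; rewrite addrK subr0 -surjective_pairing.
  have [c2|c2] := pselect (piece i (p.1, p.2 + s m)); last first.
    by right; right; split => //=; rewrite addrK subr0 -surjective_pairing.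
  by left; split => //; split; rewrite /= addr0.
have b1 : (mu2 A1 <= (2 * d)%:E)%E.
  by apply: le_trans (leb2_translate1_le _ _ _ mB1) _; rewrite EFinM lee_pmul2l.
have b2 : (mu2 A2 <= (2 * d)%:E)%E.
  by apply: le_trans (leb2_translate2_le _ _ _ mB2) _; rewrite EFinM lee_pmul2l.
have mG := measurable_good_corner m i.
have mA : measurable (A1 `|` A2) by exact: measurableU.
have bound : (mu2 (E i) <= mu2 (good_corner m i) + (4 * d)%:E)%E.
  apply: le_trans (leb2_le _ _ _ (measurable_seqDU_piece i) (measurableU _ _ mG mA) sub) _.
  apply: le_trans (leb2_setU _ _ _ mG mA) _; apply: leeD => //.
  apply: le_trans (leb2_setU _ _ _ mA1 mA2) _.
  by apply: le_trans (leeD b1 b2) _; rewrite -EFinD -mulrDl -natrD.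
apply: (@le_trans _ _ (((slope i) ^+ 2)%:E * (mu2 (good_corner m i) + (4 * d)%:E))%E).
  by rewrite lee_pmul2l ?lte_fin.
rewrite ge0_muleDr; [|exact: measure_ge0|by rewrite lee_fin mulr_ge0 // ltW].
rewrite -EFinM.
have eq3 (x y : R) : x != 0 -> x ^+ 2 * (4 * (y / (4 * x ^+ 2))) = y by move=> x0; field.
by rewrite /d eq3.
Qed.

(** The mesh tends to zero in [slope_good_corner]. The sum is finite, so one [m] is fine enough for
    all its pieces. *)
Lemma slope_area N :
  (\sum_(i < N) ((slope i) ^+ 2)%:E * mu2 (E i) <= (64 * k)%:E * mu2 (F @` U))%E.
Proof.
apply/lee_addgt0Pr => e e0.
suff [m Hm] : exists m, (\sum_(i < N) ((slope i) ^+ 2)%:E * mu2 (E i) <=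
    \sum_(i < N) ((slope i) ^+ 2)%:E * mu2 (good_corner m i) + e%:E)%E.
  by apply: le_trans Hm _; apply: leeD => //; exact: slope_good_corner.
suff [m _ Hm] : \forall m \near \oo, (\sum_(i < N) ((slope i) ^+ 2)%:E * mu2 (E i) <=
    \sum_(i < N) ((slope i) ^+ 2)%:E * mu2 (good_corner m i) + e%:E)%E.
  by exists m; exact: Hm (leqnn m).
elim: N e e0 => [|N IH] e e0.
  by apply: nearW => m; rewrite !big_ord0 add0e lee_fin ltW.
have e2 : 0 < e / 2 by rewrite divr_gt0.
have [N1 _ H1] := IH _ e2; have [N2 _ H2] := good_corner_approx N _ e2.
exists (maxn N1 N2) => // m /=; rewrite geq_max => /andP[m1 m2].
have h1 := H1 _ m1; have h2 := H2 _ m2.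
rewrite !big_ord_recr /=; apply: le_trans (leeD h1 h2) _.
by rewrite addeACA -EFinD -splitr.
Qed.

End Pieces.

(** * The length-area inequality *)

Section LengthArea.
Variable R : realType.
Local Notation mu := (@lebesgue_measure R).
Local Notation mu2 := (@leb2 R).

Lemma norm_le_cabs (z : R * R) : `|z| <= cabs z.
Proof.
rewrite norm_pair_le /cabs -!sqrtr_sqr.
by rewrite !ler_wsqrtr // ?lerDl ?lerDr sqr_ge0.
Qed.

(* On a piece of slope [s] the length density is at most [4 s + 4 tau], and [4 s <= 4 s ^ 2 / tau + tau]. *)
Lemma vertical_length_area (F : R * R -> R * R) (U : set (R * R)) (g : R * R -> R)
    (k tau c d : R) :
  open U -> (forall z, U z -> {for z, continuous F}) ->
  (forall z w, U z -> U w -> F z = F w -> z = w) ->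
  U `<=` box (-1) 1 (-1) 1 -> 0 < k -> k <= 1 -> 0 < tau ->
  (forall z w, `|g z - g w| <= `|F z - F w|) ->
  (forall z, U z -> c <= z.2 <= d) ->
  {ae mu2, forall z, U z -> [/\ derivable F z (1, 0), derivable F z (0, 1) &
     'D_((1, 0) : R * R) F z = k^-1 *: mulNi ('D_((0, 1) : R * R) F z)]} ->
  {ae mu, forall x, (exists y, U (x, y)) -> abs_cont_on c d (fun y => F (x, y))} ->
  exists Psi : measurableTypeR R -> \bar R, [/\ measurable_fun setT Psi, (forall x, (0 <= Psi x)%E),
    {ae mu, forall x, (mu [set g (x, y) | y in [set y | U (x, y)]] <= Psi x)%E} &
    (\int[mu]_x Psi x <= (256 * k / tau)%:E * mu2 (F @` U) + (5 * tau)%:E * mu2 U)%E].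
Proof.
move=> oU cF iF Ub k0 k1 tau0 gF Ucd aeD aeAC.
pose E := seqDU (piece R F U k tau).
pose s i := slope R i.
have s0 i : 0 <= s i by exact: slope_ge0.
have mE i : measurable (E i) by exact: measurable_seqDU_piece.
have tE : trivIset setT E by exact: trivIset_seqDU.
have EU i : E i `<=` U by exact: seqDU_piece_sub.
have mU : measurable U by exact: open_measurable_prod.
have mUE : measurable (\bigcup_i E i) by exact: bigcupT_measurable.
have UEU : \bigcup_i E i `<=` U by move=> z [i _ /EU].
pose C i : R := 4 * s i + 4 * tau.
have C0 i : 0 <= C i by have := s0 i; rewrite /C; lra.
(* The lengths are outer measures, not known to be measurable in [x], hence a measurable majorant.
   The coefficient [C i] is twice the Lipschitz constant [2 * s i + 2 * tau] on the piece, by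
   [lebesgue_locally_lipschitz_image]. *)
pose Psi (x : measurableTypeR R) := (\sum_(i <oo) (C i)%:E * mu (xsection (E i) x))%E.
have mPsi i : measurable_fun setT (fun x : measurableTypeR R => (C i)%:E * mu (xsection (E i) x))%E.
  by apply: measurable_funeM; apply: measurable_fun_xsection; exact: mE.
have Psi0 i x : (0 <= (C i)%:E * mu (xsection (E i) x))%E by rewrite mule_ge0 ?lee_fin.
exists Psi; split.
- by apply: ge0_emeasurable_sum => // i x _ _; exact: Psi0.
- by move=> x; apply: nneseries_ge0 => i _ _; exact: Psi0.
(* The points in no piece form a null set. On almost every vertical line it has a null section,
   which contributes no length by Lusin's property. *)
- pose N := U `\` \bigcup_i E i.
  have mN : measurable N by exact: measurableD.
  have N0 : mu2 N = 0%E.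
    have [A [mA A0 NA]] := aeD.
    apply/eqP; rewrite eq_le measure_ge0 andbT -A0.
    apply: leb2_le => // z [Uz nE]; apply: NA => /= /(_ Uz)[d1 d2 Ez].
    have [i pz] := @piece_cover R F U k tau oU k0 k1 tau0 z Uz d1 d2 Ez.
    apply: nE; have : (\bigcup_i piece R F U k tau i) z by exists i.
    by rewrite -seqDU_bigcup_eq.
  have := ae_and _ _ _ (leb2_null_xsection _ _ mN N0) aeAC.
  apply: ae_mono => x [Nx0 AC].
  have [Ux|nUx] := pselect (exists y, U (x, y)); last first.
    rewrite (_ : [set g (x, y) | y in _] = set0) ?measure0; last first.
      by rewrite -subset0 => t [y Uy _]; apply: nUx; exists y.
    by apply: nneseries_ge0 => i _ _; exact: Psi0.
  have {}AC := AC Ux.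
  have -> : [set g (x, y) | y in [set y | U (x, y)]] =
      [set g (x, y) | y in xsection N x] `|` \bigcup_i [set g (x, y) | y in xsection (E i) x].
    rewrite -image_bigcup -image_setU; congr (_ @` _); apply/seteqP; split => y /=.
      move=> Uy; have [[j _ Ej]|nE] := pselect ((\bigcup_i E i) (x, y)).
        by right; exists j => //; rewrite /xsection /= inE.
      by left; rewrite /xsection /= inE.
    by case=> [|[j _]]; rewrite /xsection /= inE; [case|exact: EU].
  apply: le_trans (lebesgue_outer_setU _ _ _) _.
  rewrite [X in (X + _)%E](_ : _ = 0%E) ?add0e; last first.
    apply: (@abs_cont_image_null R c d (fun y => F (x, y)) (fun y => g (x, y))) => //.
      by move=> y y'; apply: le_trans (gF _ _) (norm_le_cabs _).
    by move=> y; rewrite /xsection /= inE => -[/Ucd]; rewrite in_itv.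
  apply: le_trans (lebesgue_outer_bigcup _ _) _.
  rewrite /Psi; apply: lee_nneseries => [i _ _|i _]; first exact: mu_ext_ge0.
  have [d' d'0 H] := @piece_lipschitz R F U k tau tau0 i.
  have L0 : 0 < 2 * s i + 2 * tau by have := s0 i; lra.
  have := @lebesgue_locally_lipschitz_image R (xsection (E i) x) (fun y => g (x, y))
    (2 * s i + 2 * tau) d' (-1) L0 d'0.
  rewrite (_ : 2 * (2 * s i + 2 * tau) = C i); last by rewrite /C; ring.
  apply; first exact: measurable_xsection.
    move=> y; rewrite /xsection /= inE => /EU/Ub[_]; rewrite /= !in_itv /= => /andP[-> _] //.
  move=> y y'; rewrite /xsection /= !inE => Ey [Ey' _] yy'.
  apply: le_trans (gF _ _) _.
  have := H _ (y - y') Ey' (ltW yy'); by rewrite /= [y' + _]addrC subrK.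
rewrite integral_nneseries //.
apply: (@le_trans _ _ (\sum_(i <oo) (C i)%:E * mu2 (E i))%E).
  apply: lee_nneseries => [i _ _|i _].
    by apply: integral_ge0 => x _; exact: Psi0.
  rewrite ge0_integralZl ?lee_fin //; apply: measurable_fun_xsection; exact: mE.
have FU0 : (0 <= mu2 (F @` U))%E by exact: measure_ge0.
apply: nneseries_le_bound => [i|n].
  by rewrite mule_ge0 ?lee_fin //; exact: measure_ge0.
apply: (@le_trans _ _ (\sum_(i < n) ((4 / tau)%:E * ((s i ^+ 2)%:E * mu2 (E i)) +
    (5 * tau)%:E * mu2 (E i)))%E).
  apply: lee_sum => i _; rewrite muleA -EFinM -ge0_muleDl; last 2 first.
  - by rewrite lee_fin mulr_ge0 ?sqr_ge0 // divr_ge0 // ltW.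
  - by rewrite lee_fin; lra.
  apply: lee_wpmul2r; first exact: measure_ge0.
  rewrite -EFinD lee_fin /C.
  have : 0 <= (s i / tau - 2^-1) ^+ 2 * (tau * 4).
    by apply: mulr_ge0; [exact: sqr_ge0|rewrite mulr_ge0 // ltW].
  rewrite (_ : _ * (_ * 4) = 4 / tau * s i ^+ 2 - 4 * s i + tau) //; first by lra.
  by field; rewrite gt_eqF.
rewrite big_split /=; apply: leeD.
  rewrite -ge0_sume_distrr; last first.
    by move=> i _; rewrite mule_ge0 ?lee_fin ?sqr_ge0 //; exact: measure_ge0.
  rewrite (_ : 256 * k / tau = (4 / tau) * (64 * k)); last by field; rewrite gt_eqF.
  rewrite (EFinM (4 / tau) (64 * k)) -muleA; apply: lee_wpmul2l; first by rewrite lee_fin divr_ge0 // ltW.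
  exact: slope_area.
rewrite -ge0_sume_distrr; last by move=> i _; exact: measure_ge0.
apply: lee_wpmul2l; first by rewrite lee_fin mulr_ge0 // ltW.
apply: le_trans (leb2_le _ _ _ mUE mU UEU).
have -> : mu2 (\bigcup_i E i) = (\sum_(i <oo) mu2 (E i))%E by exact: measure_semi_bigcup.
rewrite -(big_mkord xpredT (fun i => mu2 (E i))).
by apply: nneseries_lim_ge => i _ _; exact: measure_ge0.
Qed.

End LengthArea.

(** * The spiralling contraction *)

Section Spin.
Variable R : realType.
Local Notation mu := (@lebesgue_measure R).
Local Notation mu2 := (@leb2 R).
Implicit Types (F : R * R -> R * R) (nu : R * R -> R).

Lemma approx_derivable F (p v L : R * R) :
  (forall e : R, 0 < e -> exists2 d : R, 0 < d & forall t : R, `|t| <= d ->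
    `|F (t *: v + p) - F p - t *: L| <= e * `|t|) ->
  derivable F p v /\ 'D_v F p = L.
Proof.
move=> H.
have cv : (fun t : R => t^-1 *: ((F \o shift p) (t *: v) - F p)) @ 0^' --> L.
  apply/cvgrPdist_le => e e0; have [d d0 Hd] := H e e0.
  apply/nbhs_ballP; exists d => //= t; rewrite /ball /= sub0r normrN => td t0.
  set X := _ - F p.
  have scal (Y : R * R) : L - t^-1 *: Y = - (t^-1 *: (Y - t *: L)).
    by rewrite scalerBr scalerA mulVf // scale1r opprB.
  rewrite scal.
  by rewrite normrN normrZ normfV mulrC ler_pdivrMr ?normr_gt0 //; exact: Hd (ltW td).
by split; [apply/cvg_ex; exists L|exact: cvg_lim cv].
Qed.

Lemma spinE (z : R * R) : spin z = (z.2 / 2, - z.1 / 2).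
Proof. by []. Qed.

Lemma norm_spin (z : R * R) : `|spin z| = `|z| / 2.
Proof.
rewrite !norm_pairE /= !normrM normrN normfV (ger0_norm (_ : 0 <= 2)) //.
by rewrite maxC /Num.max ltr_pM2r //; case: ifP.
Qed.

Lemma norm_iter_spin j (z : R * R) : `|iter j spin z| = `|z| / 2 ^+ j.
Proof.
elim: j => [|j IH]; first by rewrite expr0 divr1.
by rewrite iterS norm_spin IH exprS invfM mulrA mulrAC.
Qed.

Lemma spin_inj : injective (@spin R).
Proof. by move=> [a b] [c d]; rewrite /spin /= => -[h1 h2]; congr pair; lra. Qed.

Lemma iter_spin_inj i : injective (iter i (@spin R)).
Proof. by elim: i => // i IH z w; rewrite !iterS => /spin_inj/IH. Qed.

Lemma continuous_spin z : {for z, continuous (@spin R)}.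
Proof.
have h1 : (fun z : R * R => z.2 / 2) @ z --> z.2 / 2.
  by apply: cvgM; [exact: cvg_snd|exact: cvg_cst].
have h2 : (fun z : R * R => - z.1 / 2) @ z --> - z.1 / 2.
  by apply: cvgM; [apply: cvgN; exact: cvg_fst|exact: cvg_cst].
exact: (cvg_pair h1 h2).
Qed.

(** A ball of the maximum norm is carried into itself by [spin]. The half-side exceeds [1 / 2], so
    the closed box around [strip] used for absolute continuity fits, and [2 * (5 / 8) ^ 2 < 1] keeps
    the square in the disk. *)
Definition central_square : set (R * R) := [set z | `|z| < 5 / 8].

Lemma square_disk : central_square `<=` @disk R.
Proof.
move=> z; rewrite /central_square /disk /= norm_pair_lt !ltr_norml => /andP[/andP[a1 a2] /andP[b1 b2]].
rewrite /cabs -[ltRHS]sqrtr1 ltr_sqrt //; nra.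
Qed.

Lemma square_spin z : central_square z -> central_square (spin z).
Proof. rewrite /central_square /= norm_spin; have := normr_ge0 z; lra. Qed.

Lemma abs_cont_half (c d : R) (g : R -> R * R) :
  abs_cont_on (c / 2) (d / 2) g -> abs_cont_on c d (fun y => g (y / 2)).
Proof.
move=> H e e0; have [dl d0 Hd] := H e e0; exists (2 * dl); first by rewrite mulr_gt0.
move=> n s t st dis sm; apply: Hd.
- by move=> i; have [? [? ?]] := st i; rewrite !ler_pM2r.
- by move=> i j ij; rewrite !ler_pM2r //; exact: dis.
- rewrite (eq_bigr (fun i => (t i - s i) / 2)) => [|i _]; last by rewrite mulrBl.
  by rewrite -mulr_suml ltr_pdivrMr // mulrC.
Qed.

Lemma abs_cont_opp_half (c d : R) (g : R -> R * R) :
  abs_cont_on (- d / 2) (- c / 2) g -> abs_cont_on c d (fun y => g (- y / 2)).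
Proof.
move=> H e e0; have [dl d0 Hd] := H e e0; exists (2 * dl); first by rewrite mulr_gt0.
move=> n s t st dis sm.
rewrite (eq_bigr (fun i => cabs (g (- s i / 2) - g (- t i / 2)))) => [|i _]; last first.
  by rewrite -cabsN opprB.
apply: (Hd n (fun i => - t i / 2) (fun i => - s i / 2)).
- by move=> i; have [? [? ?]] := st i; rewrite !ler_pM2r // !lerN2.
- by move=> i j ij; rewrite !ler_pM2r // !lerN2; have [h|h] := dis _ _ ij; [right|left].
- rewrite (eq_bigr (fun i => (t i - s i) / 2)) => [|i _]; last first.
    by rewrite !mulNr opprK addrC mulrBl.
  by rewrite -mulr_suml ltr_pdivrMr // mulrC.
Qed.

(** For a real coefficient [m] the Beltrami equation is [f_x = - i * nu * f_y] with
    [nu = (1 + m) / (1 - m)]. This form behaves simply under quarter turns. *)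
Definition beltrami_ae (nu : R * R -> R) (F : R * R -> R * R) : Prop :=
  {ae mu2, forall z, central_square z -> [/\ derivable F z (1, 0), derivable F z (0, 1) &
     'D_((1, 0) : R * R) F z = nu z *: mulNi ('D_((0, 1) : R * R) F z)]}.

(** The quarter turn exchanges horizontal and vertical segments, reversing the orientation of one
    family; the two conditions of [ACL] are swapped. *)
Lemma ACL_spin F : ACL central_square F -> ACL central_square (F \o spin).
Proof.
move=> H a b c d sub.
have sub' : `[c / 2, d / 2]%classic `*` `[- b / 2, - a / 2]%classic `<=` central_square.
  move=> [u v] [/=]; rewrite !in_itv /= => /andP[? ?] /andP[? ?].
  have : central_square (- v * 2, u * 2).
    by apply: sub; split; rewrite /= in_itv /=; apply/andP; split; lra.
  by move/square_spin; rewrite spinE /= -mulNr opprK !mulfK.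
have [h1 h2] := H _ _ _ _ sub'.
have n2 : 2^-1 != 0 :> R by rewrite invr_eq0.
have n2' : - 2^-1 != 0 :> R by rewrite oppr_eq0.
split.
  have := ae_affine _ _ _ 0 n2 h2; apply: ae_mono => y /= h yP.
  have E x : (F \o spin) (x, y) = F (2^-1 * y + 0, - x / 2).
    by rewrite /= spinE /= addr0 [_ * y]mulrC.
  have {h} := h _; rewrite in_itv /= => h.
  have {h} := h ltac:(move: yP; rewrite in_itv /= => /andP[? ?]; apply/andP; split; lra).
  move=> /abs_cont_opp_half.
  have -> : (fun x => F (spin (x, y))) = (fun x => F (2^-1 * y + 0, - x / 2)).
    by apply/funext => x; rewrite -E.
  by [].
have := ae_affine _ _ _ 0 n2' h1; apply: ae_mono => x /= h xP.
have E y : (F \o spin) (x, y) = F (y / 2, - 2^-1 * x + 0).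
  by rewrite /= spinE /= addr0 !mulNr [_ * x]mulrC.
have {h} := h _; rewrite in_itv /= => h.
have {h} := h ltac:(move: xP; rewrite in_itv /= => /andP[? ?]; apply/andP; split; lra).
move=> /abs_cont_half.
have -> : (fun y => F (spin (x, y))) = (fun y => F (y / 2, - 2^-1 * x + 0)).
  by apply/funext => y; rewrite -E.
by [].
Qed.

Lemma beltrami_rotate (X Y a b : R * R) (n : R) : n != 0 ->
  X = - 2^-1 *: a -> Y = 2^-1 *: b -> b = n *: mulNi a -> X = n^-1 *: mulNi Y.
Proof.
move=> n0 -> -> ->; rewrite [LHS]surjective_pairing [RHS]surjective_pairing /= /GRing.scale /=.
by congr pair; field.
Qed.

(** By the chain rule along the axes, the horizontal derivative of [F \o spin] is [- 1 / 2] times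
    the vertical one of [F], and the vertical one is half the horizontal one of [F]. Exchanging the
    two inverts [nu]. *)
Lemma beltrami_ae_spin nu F : (forall z, nu z != 0) -> beltrami_ae nu F ->
  beltrami_ae (fun z => (nu (spin z))^-1) (F \o spin).
Proof.
move=> nu0 /ae2_spin [A [mA A0 HA]]; exists A; split => // z nP; apply: HA => /= h; apply: nP => pz.
have {h} [d1 d2 E] := h (square_spin _ pz).
have [e1 D1] : derivable (F \o spin) z (1, 0) /\
    'D_((1, 0) : R * R) (F \o spin) z = - 2^-1 *: 'D_((0, 1) : R * R) F (spin z).
  apply: approx_derivable => e e0; have [d d0 Hd] := derivable_approx _ _ _ _ _ e0 d2.
  exists d => // t td; have t2 : `|- 2^-1 * t| <= `|t|.
    have -> : `|- 2^-1 * t| = `|t| / 2 by rewrite mulNr normrN mulrC normrM normfV [`|2|]ger0_norm.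
    by have := normr_ge0 t; lra.
  have := Hd (- 2^-1 * t) (le_trans t2 td).
  have -> : (- 2^-1 * t) *: (0, 1) + spin z = spin (t *: (1, 0) + z) :> R * R.
    rewrite !spinE [LHS]surjective_pairing /= /GRing.scale /=.
    by congr pair; lra.
  rewrite (scalerA t) [t * _]mulrC => /le_trans; apply.
  by rewrite ler_wpM2l // ltW.
have [e2 D2] : derivable (F \o spin) z (0, 1) /\
    'D_((0, 1) : R * R) (F \o spin) z = 2^-1 *: 'D_((1, 0) : R * R) F (spin z).
  apply: approx_derivable => e e0; have [d d0 Hd] := derivable_approx _ _ _ _ _ e0 d1.
  exists d => // t td; have t2 : `|2^-1 * t| <= `|t|.
    have -> : `|2^-1 * t| = `|t| / 2 by rewrite mulrC normrM normfV [`|2|]ger0_norm.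
    by have := normr_ge0 t; lra.
  have := Hd (2^-1 * t) (le_trans t2 td).
  have -> : (2^-1 * t) *: (1, 0) + spin z = spin (t *: (0, 1) + z) :> R * R.
    rewrite !spinE [LHS]surjective_pairing /= /GRing.scale /=.
    by congr pair; lra.
  rewrite (scalerA t) [t * _]mulrC => /le_trans; apply.
  by rewrite ler_wpM2l // ltW.
by split; [exact: e1|exact: e2|exact: (beltrami_rotate _ _ _ _ _ (nu0 _) D1 D2 E)].
Qed.

Lemma good_iter_spin nu F j : (forall z, nu z != 0) -> ACL central_square F -> beltrami_ae nu F ->
  ACL central_square (F \o iter j spin) /\
  beltrami_ae (fun z => if odd j then (nu (iter j spin z))^-1 else nu (iter j spin z))
    (F \o iter j spin).
Proof.
move=> nu0 aF bF; elim: j => [//|j [IH1 IH2]].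
have E : F \o iter j.+1 spin = (F \o iter j spin) \o spin.
  by apply/funext => z; rewrite /= -iterS iterSr.
rewrite E; split; first exact: ACL_spin.
have := beltrami_ae_spin _ _ _ IH2.
have E' : (fun z => (if odd j then (nu (iter j spin (spin z)))^-1 else nu (iter j spin (spin z)))^-1) =
   (fun z => if odd j.+1 then (nu (iter j.+1 spin z))^-1 else nu (iter j.+1 spin z)).
  by apply/funext => z; rewrite /= -iterS iterSr; case: (odd j); rewrite //= invrK.
by rewrite E'; apply => z; case: (odd j); rewrite ?invr_eq0.
Qed.

Definition strip : set (R * R) :=
  [set z | 1 / 8 < z.1 < 1 / 4 /\ - z.1 / 2 < z.2 < 2 * z.1].

Lemma iter_spin4 (z : R * R) : iter 4 spin z = (z.1 / 16, z.2 / 16).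
Proof. by rewrite /= !spinE /=; congr pair; lra. Qed.

(** The first three turns move the wedge between the lines [y = - x / 2] and [y = 2 * x] off itself.
    The fourth is division by 16, which leaves the wedge invariant but brings [x] below [1 / 8]. The
    lower bound on [w.1] is relaxed to 0 so that the induction can restart from there. *)
Lemma strip_spin_disjoint d (w : R * R) : 0 < w.1 -> w.1 < 1 / 4 ->
  - w.1 / 2 < w.2 < 2 * w.1 -> ~ strip (iter d.+1 spin w).
Proof.
elim/ltn_ind: d w => d IH w w0 w1 /andP[w2 w3].
case: d IH => [|[|[|d]]] IH; rewrite /strip.
- by rewrite /= => -[_ /andP[? ?]]; lra.
- by rewrite /= => -[/andP[? ?] _]; lra.
- by rewrite /= => -[_ /andP[? ?]]; lra.
rewrite -[d.+4]addn4 iterD iter_spin4.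
case: d IH => [|d] IH; first by rewrite /= => -[/andP[? ?] _]; lra.
by apply: (IH d _) => /=; [lia|lra|lra|apply/andP; split; lra].
Qed.

Lemma strip_iter_spin_inj i j (z w : R * R) : strip z -> strip w ->
  iter i spin z = iter j spin w -> i = j.
Proof.
wlog ij : i j z w / (i <= j)%N.
  by move=> H sz sw E; case/orP: (leq_total i j) => h; [exact: H E|exact/esym/(H _ _ _ _ h sw sz)/esym].
move=> sz sw; rewrite -(subnKC ij) iterD => E.
have {}E : z = iter (j - i) spin w.
  exact: (iter_spin_inj i).
case Ed : (j - i)%N => [|d]; first by rewrite addn0.
have [/andP[h1 h2] h3] := sw.
by exfalso; apply: (strip_spin_disjoint d w); rewrite -?Ed -?E //; lra.
Qed.

End Spin.

Arguments central_square {R}.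
Arguments strip {R}.

(** * Contradiction along the spirals *)

Section Contradiction.
Variable R : realType.
Local Notation mu := (@lebesgue_measure R).
Local Notation mu2 := (@leb2 R).
Variables (f : R * R -> R * R) (nu : R * R -> R) (K : nat -> R).
Hypothesis hf : homeomorphism_on (@disk R) f.
Hypothesis aclf : ACL central_square f.
Hypothesis beltf : beltrami_ae R nu f.
Hypothesis nu0 : forall z, nu z != 0.
Hypothesis nuK : forall j z, strip z ->
  nu (iter j spin z) = if odd j then (K j)^-1 else K j.
Hypothesis K1 : forall j, 1 <= K j.
Hypothesis sumK : (\sum_(j <oo) ((K j)^-1)%:E < +oo)%E.

Let F (j : nat) : R * R -> R * R := f \o iter j spin.
Let h (j : nat) (z : R * R) : R := `|F j z - f 0|.
Let U (r : R) (j : nat) : set (R * R) := [set z | strip z /\ h j z < r].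

Lemma open_square : open (@central_square R).
Proof.
apply: (@open_comp _ _ (fun z : R * R => `|z|) [set y | y < 5 / 8]); last exact: open_lt.
by move=> z _; exact: norm_continuous.
Qed.

Lemma open_strip : open (@strip R).
Proof.
have c1 : continuous (fun z : R * R => z.1) by move=> z; exact: cvg_fst.
have c2 : continuous (fun z : R * R => z.2) by move=> z; exact: cvg_snd.
have -> : @strip R = [set z | 1 / 8 < z.1] `&` [set z | 0 < 1 / 4 - z.1] `&`
    ([set z | 0 < z.2 + z.1 / 2] `&` [set z | 0 < 2 * z.1 - z.2]).
  apply/seteqP; split => z /=.
    by move=> [/andP[? ?] /andP[? ?]]; repeat split; lra.
  by move=> [[? ?] [? ?]]; split; apply/andP; split; lra.
have op (G : R * R -> R) (a : R) : continuous G -> open [set z | a < G z].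
  by move=> cG; apply: (@open_comp _ _ G [set y | a < y]) => //; exact: open_gt.
apply: openI; apply: openI; apply: op => // z.
- by apply: cvgB; [exact: cvg_cst|exact: c1].
- by apply: cvgD; [exact: c2|apply: cvgM; [exact: c1|exact: cvg_cst]].
- by apply: cvgB; [apply: cvgM; [exact: cvg_cst|exact: c1]|exact: c2].
Qed.

Lemma strip_square : @strip R `<=` central_square.
Proof.
move=> z [/andP[? ?] /andP[? ?]]; rewrite /central_square /= norm_pair_lt !ltr_norml.
by apply/andP; split; apply/andP; split; lra.
Qed.

Lemma square_iter_spin j z : central_square z -> central_square (iter j (@spin R) z).
Proof. by move=> pz; elim: j => //= j; exact: square_spin. Qed.

Lemma continuous_square z : central_square z -> {for z, continuous f}.
Proof.
move=> pz; have [cf _] := hf.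
have := continuous_subspaceW (@square_disk R) cf.
rewrite continuous_open_subspace; last exact: open_square.
by apply; rewrite inE.
Qed.

Lemma continuous_F j z : central_square z -> {for z, continuous (F j)}.
Proof.
move=> pz; apply: continuous_comp; last by apply: continuous_square; exact: square_iter_spin.
elim: j => [|j IH]; first exact: cvg_id.
by rewrite /= ; apply: (@continuous_comp _ _ _ (iter j spin) spin) => //; exact: continuous_spin.
Qed.

Lemma F_inj j z w : central_square z -> central_square w -> F j z = F j w -> z = w.
Proof.
move=> pz pw E; have [_ [injf _]] := hf; apply: (@iter_spin_inj R j).
by apply: injf => //; rewrite inE; apply: square_disk; exact: square_iter_spin.
Qed.

Lemma continuous_h j z : central_square z -> {for z, continuous (h j)}.
Proof.
move=> pz; apply: cvg_norm; apply: cvgB; last exact: cvg_cst.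
exact: continuous_F.
Qed.

Lemma open_U r j : open (U r j).
Proof.
rewrite openE => z [sz hz]; apply: filterI; first exact: open_strip.
apply: (continuous_h j z (strip_square _ sz) [set y | y < r]).
by apply: open_nbhs_nbhs; split => //; exact: open_lt.
Qed.

Lemma U_box r j : U r j `<=` box (- 2^-1) (2^-1) (- 2^-1) (2^-1).
Proof.
move=> z [[/andP[? ?] /andP[? ?]] _].
by split; rewrite /= in_itv /=; apply/andP; split; lra.
Qed.

(** Continuity of the inverse map at [f 0]. It keeps the early turns of every spiral out of the
    region [|f - f 0| < r]. *)
Lemma small_preimage (eta : R) : 0 < eta -> exists2 r : R, 0 < r &
  forall z, central_square z -> `|f z - f 0| < r -> `|z| < eta.
Proof.
move=> eta0; have [_ [_ [g [gf cg]]]] := hf.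
have p0 : central_square (0 : R * R) by rewrite /central_square /= normr0 divr_gt0.
have d0 : disk (0 : R * R) by exact: square_disk.
have A0 : (f @` @disk R) (f 0) by exists 0.
have nb : nbhs (g (f 0)) [set z : R * R | `|z| < eta].
  rewrite gf //; apply: open_nbhs_nbhs; split; last by rewrite /= normr0.
  apply: (@open_comp _ _ (fun z : R * R => `|z|) [set y | y < eta]); last exact: open_lt.
  by move=> z _; exact: norm_continuous.
have nbA : within (f @` @disk R) (nbhs (f 0)) (g @^-1` [set z | `|z| < eta]).
  by rewrite nbhs_subspace_in //; exact: (cg (f 0) _ nb).
have {nbA} /nbhs_ballP[r /= r0 H] := nbA.
exists r => // z pz zr; rewrite -[z]gf; last exact: square_disk.
apply: H; last by exists z => //; exact: square_disk.
by move: zr; rewrite distrC norm_pair_lt => /andP[? ?]; split.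
Qed.

(* [h j] at the lower end of a segment is [h j.+1] at its upper end, so [h] is continuous along the
   spiral and tends to [0]; the intermediate value theorem applies. *)
Lemma spiral_cover (r : R) (J : nat) (x : R) : 1 / 8 < x < 1 / 4 ->
  (forall j, (j <= J)%N -> r <= h j (x, 2 * x)) -> 0 < r ->
  (r%:E <= \sum_(i <oo) mu [set h (i + J) (x, y) | y in [set y | U r (i + J) (x, y)]])%E.
Proof.
move=> xP big r0; have /andP[x1 x2] := xP.
pose v j := h j (x, 2 * x).
have seg y : - x / 2 <= y <= 2 * x -> central_square (x, y).
  move=> /andP[? ?]; rewrite /central_square /= norm_pair_lt !ltr_norml /=.
  by apply/andP; split; apply/andP; split; lra.
have vS j : h j (x, - x / 2) = v j.+1.
  rewrite /v /h /F /= -!iterS !iterSr spinE /=.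
  by rewrite (_ : 2 * x / 2 = x) //; lra.
have v_cvg : v @ \oo --> 0.
  have p0 : central_square (0 : R * R) by rewrite /central_square /= normr0 divr_gt0.
  have i0 : (fun j => iter j spin (x, 2 * x)) @ \oo --> (0 : R * R).
    apply/cvgr0Pnorm_lt => e e0.
    have : (fun j => `|(x, 2 * x)| * 2^-1 ^+ j) @ \oo --> (0 : R).
      rewrite -(mulr0 `|(x, 2 * x)|); apply: cvgM; first exact: cvg_cst.
      by apply: cvg_expr; rewrite ger0_norm // invf_lt1 // ltr1n.
    move=> /cvgr0Pnorm_lt /(_ _ e0); apply: filterS => j.
    rewrite norm_iter_spin ger0_norm ?mulr_ge0 // ?exprn_ge0 //.
    by rewrite exprVn.
  have c0 := continuous_square _ p0.
  have : (fun j => `|f (iter j spin (x, 2 * x)) - f 0|) @ \oo --> `|f 0 - f 0|.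
    apply: cvg_norm; apply: cvgB; last exact: cvg_cst.
    by apply: (cvg_comp _ f i0); exact: c0.
  by rewrite subrr normr0.
have step s : 0 < s -> s < r -> (exists j, s = v j) \/
    exists i, [set h (i + J) (x, y) | y in [set y | U r (i + J) (x, y)]] s.
  move=> s0 sr.
  have /cvgr0Pnorm_lt /(_ _ s0)[N _ NP] := v_cvg.
  have ex : exists n, v n < s.
    by exists N; apply: le_lt_trans (NP N (leqnn N)); exact: ler_norm.
  (* The first vertex with value below [s] comes after index [J]. The value [s] is therefore taken
     on the segment of the preceding index, whose upper end still has value at least [s]. *)
  have [m vm minm] := ex_minnP ex.
  have Jm : (J < m)%N.
    rewrite ltnNge; apply/negP => mJ; have := big _ mJ; rewrite -/(v m); lra.
  case: m vm minm Jm => // m vm minm Jm.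
  have vmge : s <= v m by rewrite leNgt; apply/negP => /minm; rewrite ltnn.
  have [E|ne] := eqVneq (v m) s; first by left; exists m.
  have lt : s < v m by rewrite lt_neqAle eq_sym ne.
  right; exists (m - J)%N; rewrite subnK //.
  have le : - x / 2 <= 2 * x by lra.
  have cont : {within `[- x / 2, 2 * x], continuous (fun y => h m (x, y))}.
    apply: continuous_in_subspaceT => y; rewrite inE /= in_itv /= => yP.
    apply: (@continuous_comp _ _ _ (fun y : R => (x, y)) (h m)).
      have h1 : (fun=> x : R) @ y --> x by exact: cvg_cst.
      have h2 : (fun y : R => y) @ y --> y by exact: cvg_id.
      exact: (cvg_pair h1 h2).
    by apply: continuous_h; exact: seg.
  have mm : Num.min (h m (x, - x / 2)) (h m (x, 2 * x)) <= s <=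
      Num.max (h m (x, - x / 2)) (h m (x, 2 * x)).
    by rewrite vS -/(v m) ge_min le_max (ltW vm) (ltW lt) orbT.
  have [y yP hy] := IVT le cont mm.
  exists y => //; rewrite /U /= hy; split => //.
  rewrite in_itv /= in yP; have /andP[y1 y2] := yP.
  (* The strip is open, so the point must not be an end of the segment; this is why values taken at
     vertices are set apart. *)
  split => //=; rewrite !lt_neqAle y1 y2 !andbT; apply/andP; split.
    by apply/eqP => E; move: vm; rewrite -vS E hy ltxx.
  by apply/eqP => E; move: lt; rewrite /v -E hy ltxx.
pose A i := [set h (i + J) (x, y) | y in [set y | U r (i + J) (x, y)]].
have sub : `]0, r[%classic `<=` range v `|` \bigcup_i A i.
  move=> s; rewrite /= in_itv /= => /andP[s0 sr].
  have [[j ->]|[i Ai]] := step s s0 sr; first by left; exists j.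
  by right; exists i.
(* The exceptional values at the vertices are countable. *)
have v0 : mu (range v) = 0%E.
  apply: countable_lebesgue_measure0; apply: (card_le_trans (card_image_le v setT)).
  exact: card_lexx.
have -> : r%:E = mu `]0, r[%classic by rewrite lebesgue_measure_itv /= lte_fin r0 sube0.
apply: le_trans (lebesgue_outer_le _ _ _ sub) _.
apply: le_trans (lebesgue_outer_setU _ _ _) _.
by rewrite v0 add0e; exact: lebesgue_outer_bigcup.
Qed.

Lemma strip_length_area (r lam : R) j : 0 < lam ->
  exists Psi : measurableTypeR R -> \bar R, [/\ measurable_fun setT Psi,
    (forall x, (0 <= Psi x)%E),
    {ae mu, forall x, (mu [set h j (x, y) | y in [set y | U r j (x, y)]] <= Psi x)%E} &
    (\int[mu]_x Psi x <= (256 * lam)%:E * mu2 (F j @` U r j) + (5 * (K j)^-1 / lam)%:E)%E].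
Proof.
move=> lam0; have [aclF beltF] := good_iter_spin _ _ _ j nu0 aclf beltf.
have K0 : 0 < K j by apply: lt_le_trans (K1 j).
have k0 : 0 < (K j)^-1 by rewrite invr_gt0.
(* With [k = 1 / K j] and [tau = k / lam], the area coefficient [256 * k / tau] becomes [256 * lam]
   for every [j]. The images can then be summed as disjoint sets, while the other term is summable
   in [j]. *)
have tau0 : 0 < (K j)^-1 / lam by rewrite divr_gt0.
have [||||||||Psi [m1 m2 m3 m4]] := @vertical_length_area R (F j) (U r j) (h j) (K j)^-1
   ((K j)^-1 / lam) (- 2^-1) (2^-1) (open_U r j) _ _ _ k0 _ tau0.
- by move=> z [sz _]; apply: continuous_F; exact: strip_square.
- by move=> z w [sz _] [sw _]; apply: F_inj; exact: strip_square.
- move=> z /U_box[]; rewrite /= !in_itv /= => /andP[? ?] /andP[? ?].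
  by split; rewrite /= in_itv /=; apply/andP; split; lra.
- by rewrite invf_le1.
- move=> z w; rewrite /h; apply: le_trans (ler_dist_dist _ _) _.
  by rewrite opprB addrA subrK.
- by move=> z /U_box[_]; rewrite /= in_itv.
- have pt (z : R * R) : (central_square z -> [/\ derivable (F j) z (1, 0), derivable (F j) z (0, 1) &
      'D_((1, 0) : R * R) (F j) z = (if odd j then (nu (iter j spin z))^-1 else nu (iter j spin z))
         *: mulNi ('D_((0, 1) : R * R) (F j) z)]) ->
      U r j z -> [/\ derivable (F j) z (1, 0), derivable (F j) z (0, 1) &
      'D_((1, 0) : R * R) (F j) z = ((K j)^-1)^-1 *: mulNi ('D_((0, 1) : R * R) (F j) z)].
    move=> H uz; have sz : strip z by case: uz.
    have [d1 d2 E] := H (strip_square _ sz); split; [exact: d1|exact: d2|].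
    by rewrite E (nuK j z sz) invrK; case: (odd j); rewrite ?invrK.
  have [A [mA A0 HA]] := beltF; exists A; split; [exact: mA|exact: A0|move=> z nP].
  by apply: HA => H; apply: nP; exact: pt H.
- have sub : `[1 / 8, 1 / 4]%classic `*` `[- 2^-1, 2^-1]%classic `<=` @central_square R.
    move=> z [/=]; rewrite !in_itv /= => /andP[? ?] /andP[? ?].
    by rewrite /central_square /= norm_pair_lt !ltr_norml; apply/andP; split; apply/andP; split; lra.
  have [_ H] := aclF _ _ _ _ sub; apply: ae_mono H => x H [y [[/andP[? ?] _] _]].
  by apply: H; rewrite in_itv /=; apply/andP; split; apply: ltW.
exists Psi; split => //; apply: le_trans m4 _; apply: leeD.
  rewrite (_ : 256 * (K j)^-1 / ((K j)^-1 / lam) = 256 * lam) //.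
  by field; rewrite !gt_eqF.
have bU : (mu2 (U r j) <= 1)%E.
  have mU : measurable (U r j) by apply: open_measurable_prod; exact: open_U.
  apply: le_trans (leb2_le _ _ _ mU (measurable_box _ _ _ _ _) (U_box r j)) _.
  by rewrite leb2_box ?lee_fin; lra.
rewrite -[leRHS]mule1 mulrA; apply: lee_wpmul2l bU.
by rewrite lee_fin -mulrA mulr_ge0 // ltW.
Qed.

Lemma beltrami_spiral_contradiction : False.
Proof.
have k_ge0 j : (0 <= ((K j)^-1)%:E)%E.
  by rewrite lee_fin invr_ge0; apply: le_trans (K1 j).
(* The tail must satisfy [5 / lam * tail <= r / 32] for the [lam] chosen below; this threshold gives
   [5 * r / 256]. *)
have [J JP] : exists J, (\sum_(J <= j <oo) ((K j)^-1)%:E < ((64 * 64 * 64 * 16)^-1)%:E)%E.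
  have /(_ _)/= cv := nneseries_tail_cvg sumK (fun j _ => k_ge0 j).
  have [N _ NP] : \forall N \near \oo, (\sum_(N <= j <oo) ((K j)^-1)%:E < ((64 * 64 * 64 * 16)^-1)%:E)%E.
    apply: (cv [set y : \bar R | (y < ((64 * 64 * 64 * 16)^-1)%:E)%E]); apply: open_nbhs_nbhs.
    by split; [exact: open_ereal_lt_ereal|rewrite /= lte_fin invr_gt0 !mulr_gt0].
  by exists N; exact: NP (leqnn N).
(* A vertex of index at most [J] has norm at least [eta], since the starting vertex has first
   coordinate above [1 / 8]. *)
pose eta : R := 2^-1 ^+ J / 8.
have eta0 : 0 < eta by rewrite divr_gt0 // exprn_gt0.
have [r r0 rP] := small_preimage eta eta0.
(* The disjoint images lie in a square of area [4 * r ^ 2], and [256 * lam * 4 * r ^ 2 = r / 16].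
   With the [r / 32] from the tail this stays below [r / 8]. *)
pose lam : R := (64 * 64 * 4 * r)^-1.
have lam0 : 0 < lam by rewrite invr_gt0 !mulr_gt0.
have [Psi PsiP] := choice (fun i => strip_length_area r lam (i + J) lam0).
have Psi0 i x : (0 <= Psi i x)%E by have [] := PsiP i.
have mPsi i : measurable_fun setT (Psi i) by have [] := PsiP i.
pose I : set R := `]1 / 8, 1 / 4[%classic.
have mI : measurable I by exact: measurable_itv.
have low : {ae mu, forall x, (r%:E * (\1_I x)%:E <= \sum_(i <oo) Psi i x)%E}.
  have : {ae mu, forall x, forall i,
      (mu [set h (i + J) (x, y) | y in [set y | U r (i + J) (x, y)]] <= Psi i x)%E}.
    by apply: ae_forall => i; have [] := PsiP i.
  apply: ae_mono => x Hx; rewrite indicE; case: (boolP (x \in I)); last first.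
    by move=> _; rewrite mule0; apply: nneseries_ge0 => i _ _; exact: Psi0.
  rewrite inE /I /= in_itv /= mule1 => xP.
  apply: le_trans (spiral_cover r J x xP _ r0) _.
    move=> j jJ; rewrite leNgt; apply/negP => hj.
    have pz : central_square (x, 2 * x).
      have /andP[? ?] := xP; rewrite /central_square /= norm_pair_lt !ltr_norml /=.
      by apply/andP; split; apply/andP; split; lra.
    have := rP _ (square_iter_spin j _ pz) hj.
    rewrite norm_iter_spin ltNge => /negP; apply.
    rewrite /eta -exprVn mulrC ler_pM ?exprn_ge0 //.
      by rewrite norm_pairE le_max /=; apply/orP; left; rewrite ger0_norm; have /andP[? ?] := xP; lra.
    by rewrite ler_wiXn2l // invf_le1 // ler1n.
  by apply: lee_nneseries => [i _ _|i _]; [exact: mu_ext_ge0|exact: Hx].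
have mS : measurable_fun setT (fun x => \sum_(i <oo) Psi i x)%E.
  by apply: ge0_emeasurable_sum => // i x _ _; exact: Psi0.
have int_low : (\int[mu]_x (r%:E * (\1_I x)%:E) = (r / 8)%:E)%E.
  rewrite ge0_integralZl //; last 2 first.
  - exact: measurableT_comp.
  - by rewrite lee_fin ltW.
  have muI : mu I = (1 / 8)%:E.
    rewrite /I lebesgue_measure_itv /= lte_fin (_ : 1 / 8 < 1 / 4); last lra.
    by rewrite -EFinB; congr EFin; lra.
  have -> : (\int[mu]_x (\1_I x)%:E = (1 / 8)%:E)%E by rewrite integral_indic // setIT.
  by rewrite -EFinM; congr EFin; lra.
pose V i := F (i + J) @` U r (i + J).
have mV i : measurable (V i).
  apply: image_open_measurable; first exact: open_U.
  by move=> z [sz _]; apply: continuous_F; exact: strip_square.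
have tV : trivIset setT V.
  move=> i i' _ _ [w [[z [sz _] <-] [z' [sz' _] E]]].
  have [_ [injf _]] := hf.
  have {}E : iter (i' + J) spin z' = iter (i + J) spin z.
    by apply: injf => //; rewrite inE; apply: square_disk; apply: square_iter_spin; exact: strip_square.
  by have := strip_iter_spin_inj _ _ _ _ _ sz' sz E; move/addIn.
pose B := [set w : R * R | `|w - f 0| < r].
have mB : mu2 B = ((2 * r) ^+ 2)%:E by apply: leb2_ball; exact: ltW.
have mmB : measurable B.
  apply: open_measurable_prod; apply: (@open_comp _ _ (fun w : R * R => `|w - f 0|) [set y | y < r]).
    by move=> w _; apply: cvg_norm; apply: cvgB; [exact: cvg_id|exact: cvg_cst].
  exact: open_lt.
have int_up : (\int[mu]_x (\sum_(i <oo) Psi i x) <= (r / 16 + r / 32)%:E)%E.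
  rewrite integral_nneseries //.
  apply: nneseries_le_bound => [i|n]; first by apply: integral_ge0 => x _; exact: Psi0.
  apply: (@le_trans _ _ (\sum_(i < n) ((256 * lam)%:E * mu2 (V i) +
      (5 / lam)%:E * ((K (i + J))^-1)%:E))%E).
    apply: lee_sum => i _; have [_ _ _ H] := PsiP i; apply: le_trans H _.
    by apply: leeD => //; rewrite -EFinM lee_fin mulrAC.
  rewrite big_split /= EFinD; apply: leeD.
    rewrite -ge0_sume_distrr; last by move=> i _; exact: measure_ge0.
    apply: (@le_trans _ _ ((256 * lam)%:E * mu2 B)%E); last first.
      rewrite mB -EFinM lee_fin /lam le_eqVlt; apply/orP; left; apply/eqP.
      by field; rewrite gt_eqF.
    apply: lee_wpmul2l; first by rewrite lee_fin mulr_ge0 // ltW.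
    have mUV : measurable (\bigcup_i V i) by exact: bigcupT_measurable.
    have VB : \bigcup_i V i `<=` B by move=> _ [i _ [z [_ hz] <-]].
    apply: le_trans (leb2_le _ _ _ mUV mmB VB).
    have -> : mu2 (\bigcup_i V i) = (\sum_(i <oo) mu2 (V i))%E by exact: measure_semi_bigcup.
    rewrite -(big_mkord xpredT (fun i => mu2 (V i))).
    by apply: nneseries_lim_ge => i _ _; exact: measure_ge0.
  rewrite -ge0_sume_distrr //.
  apply: (@le_trans _ _ ((5 / lam)%:E * ((64 * 64 * 64 * 16)^-1)%:E)%E); last first.
    by rewrite -EFinM lee_fin /lam invrK; have := r0; lra.
  apply: lee_wpmul2l; first by rewrite lee_fin divr_ge0 // ltW.
  apply: le_trans (ltW JP).
  rewrite -(big_mkord xpredT (fun i => ((K (i + J))^-1)%:E)).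
  rewrite -[n](addnK J) -(big_addn 0 (n + J) J xpredT (fun i => ((K i)^-1)%:E)) add0n.
  by apply: nneseries_lim_ge => i _ _.
have : ((r / 8)%:E <= (r / 16 + r / 32)%:E :> \bar R)%E.
  rewrite -int_low; apply: le_trans int_up; apply: ae_ge0_le_integral => //.
  - by move=> x _; rewrite mule_ge0 // ?lee_fin ?ltW.
  - by apply: measurable_funeM; exact: measurableT_comp.
  - by move=> x _; apply: nneseries_ge0 => i _ _; exact: Psi0.
  - by apply: ae_mono low => x Hx _.
by rewrite lee_fin; have := r0; lra.
Qed.

End Contradiction.

(** * The Beltrami coefficient *)

Section Coefficient.
Variable R : realType.
Local Notation mu := (@lebesgue_measure R).
Local Notation mu2 := (@leb2 R).
Variables (K : nat -> R).
Hypothesis K1 : forall j, 1 <= K j.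

Definition spin_strip (j : nat) : set (R * R) := iter j spin @` strip.

(* Positive coefficients stretch horizontally, and each [spin] is a quarter turn: the signs
   alternate. *)
Definition strip_coef (j : nat) : R := (-1) ^+ odd j * ((K j - 1) / (K j + 1)).

Definition spiral_coef (z : R * R) : R :=
  match pselect (exists j, spin_strip j z) with
  | left H => strip_coef (projT1 (cid H))
  | right _ => 0
  end.

Definition spiral_mu (z : R * R) : R * R := (spiral_coef z, 0).

(** A countable partition of the disk on whose cells the coefficient is constant; index 0 is the
    part outside the spiral, where it vanishes. *)
Definition disk_cell (i : nat) : set (R * R) :=
  if i is j.+1 then spin_strip j else @disk R `\` \bigcup_j spin_strip j.

Lemma spin_strip_inj i j z : spin_strip i z -> spin_strip j z -> i = j.
Proof. by move=> [v sv <-] [w sw E]; exact/esym/(strip_iter_spin_inj _ _ _ _ _ sw sv). Qed.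

Lemma spiral_coefE j z : spin_strip j z -> spiral_coef z = strip_coef j.
Proof.
move=> sz; rewrite /spiral_coef; case: pselect => [H|[]]; last by exists j.
by case: cid => i /= si; rewrite (spin_strip_inj _ _ _ si sz).
Qed.

Lemma spiral_coef_out z : (forall j, ~ spin_strip j z) -> spiral_coef z = 0.
Proof. by move=> H; rewrite /spiral_coef; case: pselect => // -[j sj]; case: (H j). Qed.

Lemma norm_strip_coef j : `|strip_coef j| = (K j - 1) / (K j + 1).
Proof.
rewrite /strip_coef normrM normrX normrN1 expr1n mul1r ger0_norm //.
by have := K1 j => k; rewrite divr_ge0 //; lra.
Qed.

Lemma norm_spiral_coef z : `|spiral_coef z| < 1.
Proof.
have [[j sj]|H] := pselect (exists j, spin_strip j z).
  rewrite (spiral_coefE _ _ sj) norm_strip_coef; have := K1 j => k.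
  by rewrite ltr_pdivrMr; lra.
by rewrite spiral_coef_out ?normr0 // => j sj; apply: H; exists j.
Qed.

Lemma cabs_spiral_mu z : cabs (spiral_mu z) = `|spiral_coef z|.
Proof. by rewrite /cabs /= expr0n /= addr0 sqrtr_sqr. Qed.

Lemma Kmu_spin_strip j z : spin_strip j z -> Kmu spiral_mu z = K j.
Proof.
move=> sz; rewrite /Kmu cabs_spiral_mu (spiral_coefE _ _ sz) norm_strip_coef.
have k := K1 j; have eq (x : R) : 1 <= x ->
  (1 + (x - 1) / (x + 1)) / (1 - (x - 1) / (x + 1)) = x.
  by move=> x1; field; rewrite ?gt_eqF ?andbT //; lra.
exact: eq.
Qed.

Lemma Kmu_out z : (forall j, ~ spin_strip j z) -> Kmu spiral_mu z = 1.
Proof.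
by move=> /spiral_coef_out z0; rewrite /Kmu cabs_spiral_mu z0 normr0 addr0 subr0 divr1.
Qed.

Lemma spin_strip_ball j : spin_strip j `<=` [set w | `|w - 0| < 2^-1 ^+ j / 2].
Proof.
move=> _ [w [/andP[? ?] /andP[? ?]] <-] /=.
rewrite subr0 norm_iter_spin mulrC -exprVn ltr_pM2l ?exprn_gt0 //.
by rewrite norm_pair_lt !ltr_norml; apply/andP; split; apply/andP; split; lra.
Qed.

Lemma spin_strip_disk j : spin_strip j `<=` @disk R.
Proof.
move=> _ [w sw <-]; apply: square_disk; apply: square_iter_spin; exact: strip_square.
Qed.

Lemma measurable_spin_strip j : measurable (spin_strip j).
Proof.
apply: image_open_measurable; first exact: open_strip.
move=> z _; elim: j => [|j IH]; first exact: cvg_id.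
by rewrite /= ; apply: (@continuous_comp _ _ _ (iter j spin) spin) => //; exact: continuous_spin.
Qed.

Lemma open_ball_prod (c : R * R) (r : R) : open [set w : R * R | `|w - c| < r].
Proof.
apply: (@open_comp _ _ (fun w : R * R => `|w - c|) [set y | y < r]); last exact: open_lt.
by move=> w _; apply: cvg_norm; apply: cvgB; [exact: cvg_id|exact: cvg_cst].
Qed.

Lemma leb2_spin_strip j : (mu2 (spin_strip j) <= (4^-1 ^+ j)%:E)%E.
Proof.
have mB : measurable [set w : R * R | `|w - 0| < 2^-1 ^+ j / 2].
  by apply: open_measurable_prod; exact: open_ball_prod.
apply: le_trans (leb2_le _ _ _ (measurable_spin_strip j) mB (spin_strip_ball j)) _.
rewrite leb2_ball ?divr_ge0 ?exprn_ge0 // lee_fin mulrC divfK // -exprM mulnC exprM.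
by rewrite (_ : 2^-1 ^+ 2 = 4^-1) //; field.
Qed.

Lemma continuous_cabs : continuous (@cabs R).
Proof.
move=> z; apply: (@continuous_comp _ _ _ (fun z : R * R => z.1 ^+ 2 + z.2 ^+ 2) Num.sqrt);
  last exact: sqrt_continuous.
apply: cvgD; [rewrite -[_ ^+ 2]/(z.1 * z.1)|rewrite -[_ ^+ 2]/(z.2 * z.2)].
  by apply: (@cvgM _ _ _ _ (fun z : R * R => z.1) (fun z : R * R => z.1)); exact: cvg_fst.
by apply: (@cvgM _ _ _ _ (fun z : R * R => z.2) (fun z : R * R => z.2)); exact: cvg_snd.
Qed.

Lemma measurable_disk : measurable (@disk R).
Proof.
apply: open_measurable_prod.
by apply: (@open_comp _ _ (@cabs R) [set y | y < 1]); [move=> z _; exact: continuous_cabs|exact: open_lt].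
Qed.

Lemma leb2_disk : (mu2 (@disk R) <= 4%:E)%E.
Proof.
have mB : measurable [set w : R * R | `|w - 0| < 1].
  by apply: open_measurable_prod; exact: open_ball_prod.
have sub : @disk R `<=` [set w : R * R | `|w - 0| < 1].
  by move=> z /= zd; rewrite subr0; apply: le_lt_trans zd; exact: norm_le_cabs.
apply: le_trans (leb2_le _ _ _ measurable_disk mB sub) _.
by rewrite leb2_ball // lee_fin; lra.
Qed.

Lemma measurable_disk_cell i : measurable (disk_cell i).
Proof.
case: i => [|j]; last exact: measurable_spin_strip.
apply: measurableD; first exact: measurable_disk.
by apply: bigcupT_measurable => j; exact: measurable_spin_strip.
Qed.

Lemma disk_cells : @disk R = \bigcup_i disk_cell i.
Proof.
apply/seteqP; split => z.
  move=> dz; have [[j sj]|H] := pselect (exists j, spin_strip j z).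
    by exists j.+1.
  by exists 0%N => //; split => // -[j _ sj]; apply: H; exists j.
by move=> [[|j] _]; [case|exact: spin_strip_disk].
Qed.

Lemma trivIset_disk_cell : trivIset setT disk_cell.
Proof.
move=> [|i] [|j] _ _ //= [z [h1 h2]].
- by case: h1 => _ []; exists j.
- by case: h2 => _ []; exists i.
- by rewrite (spin_strip_inj _ _ _ h1 h2).
Qed.

(** Applied both to the coefficient and to its dilatation composed with [Phi]. *)
Lemma measurable_disk_cellwise d (T : measurableType d) (g : R * R -> T) (c : nat -> T) :
  (forall i z, disk_cell i z -> g z = c i) -> measurable_fun (@disk R) g.
Proof.
move=> gc; rewrite disk_cells; apply/measurable_fun_bigcup; first exact: measurable_disk_cell.
move=> i; apply: (eq_measurable_fun (cst (c i))); last exact: measurable_cst.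
by move=> z; rewrite inE => /gc.
Qed.

Lemma measurable_spiral_mu : measurable_fun (@disk R) spiral_mu.
Proof.
pose c (i : nat) : R * R := if i is j.+1 then (strip_coef j, 0) else (0, 0).
apply: (measurable_disk_cellwise _ _ spiral_mu c).
move=> [|j] z zc; rewrite /spiral_mu; last by rewrite (spiral_coefE j).
by rewrite spiral_coef_out // => j sj; case: zc => _; apply; exists j.
Qed.

Lemma disk_spiral_mu z : @disk R (spiral_mu z).
Proof. by rewrite /disk /= cabs_spiral_mu norm_spiral_coef. Qed.

(** The integral splits over the cells: the outer cell has dilatation 1 and area at most 4, and the
    strip of index [j] has area at most [1 / 4 ^ j]. *)
Lemma integral_Kmu_spiral (Phi : \bar R -> \bar R) : nonneg_on_ext Phi ->
  (Phi 1%E < +oo)%E -> (\sum_(j <oo) Phi (K j)%:E * (4^-1 ^+ j)%:E < +oo)%E ->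
  (\int[mu2]_(z in @disk R) Phi (Kmu spiral_mu z)%:E < +oo)%E.
Proof.
move=> Phi0 Phi1 sumPhi.
pose c i := if i is j.+1 then Phi (K j)%:E else Phi 1%E.
have cE i z : disk_cell i z -> Phi (Kmu spiral_mu z)%:E = c i.
  case: i => [|j] zc /=; last by rewrite (Kmu_spin_strip j).
  by rewrite Kmu_out // => j sj; case: zc => _; apply; exists j.
have c0 i : (0 <= c i)%E.
  by case: i => [|j]; apply: Phi0; rewrite lee_fin // (le_trans _ (K1 j)).
have fin0 : (Phi 1%E * 4%:E < +oo)%E.
  have p1 : (0 <= Phi 1%E)%E by apply: Phi0; rewrite lee_fin.
  apply: lte_mul_pinfty; [exact: p1| |exact: ltry].
  by apply/fin_numPlt; rewrite Phi1 andbT; apply: lt_le_trans p1.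
have mf : measurable_fun (@disk R) (fun z => Phi (Kmu spiral_mu z)%:E).
  exact: (measurable_disk_cellwise _ _ _ c).
move: mf; rewrite disk_cells => mf.
rewrite ge0_integral_bigcup //; last 3 first.
- exact: measurable_disk_cell.
- by move=> z [i _ /cE ->].
- exact: trivIset_disk_cell.
apply: le_lt_trans (lte_add_pinfty fin0 sumPhi).
have intE i : (\int[mu2]_(x in disk_cell i) Phi (Kmu spiral_mu x)%:E = c i * mu2 (disk_cell i))%E.
  rewrite -integral_cst; last exact: measurable_disk_cell.
  by apply: eq_integral => z; rewrite inE => /cE.
apply: nneseries_le_bound => [i|n].
  by rewrite intE mule_ge0.
case: n => [|n]; first by rewrite big_ord0 adde_ge0 ?mule_ge0 ?Phi0 // nneseries_ge0 // => j _ _; rewrite mule_ge0 ?(c0 j.+1) ?lee_fin ?exprn_ge0.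
rewrite big_ord_recl; apply: leeD.
  rewrite intE; apply: lee_wpmul2l; first exact: c0.
  apply: le_trans leb2_disk; apply: leb2_le; [exact: measurable_disk_cell|exact: measurable_disk|].
  by move=> z [].
apply: (@le_trans _ _ (\sum_(j < n) Phi (K j)%:E * (4^-1 ^+ j)%:E)%E).
  apply: lee_sum => j _; rewrite intE /=; apply: lee_wpmul2l; first exact: (c0 j.+1).
  exact: leb2_spin_strip.
rewrite -(big_mkord xpredT (fun j => Phi (K j)%:E * (4^-1 ^+ j)%:E)%E).
by apply: nneseries_lim_ge => j _ _; rewrite mule_ge0 ?(c0 j.+1) ?lee_fin ?exprn_ge0.
Qed.

(** Collecting terms gives [(1 - m) * a = (1 + m) * (- i) * b]. *)
Lemma real_beltrami (m : R) (a b : R * R) : `|m| < 1 ->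
  2^-1 *: (a + cmuli b) = cmul (m, 0) (2^-1 *: (a - cmuli b)) ->
  a = ((1 + m) / (1 - m)) *: mulNi b.
Proof.
case: a => a1 a2; case: b => b1 b2; rewrite ltr_norml => /andP[m1 m2].
rewrite /cmul /cmuli /mulNi => -[E1 E2].
have {}E1 : 2^-1 * (a1 - b2) = m * (2^-1 * (a1 - - b2)) - 0 * (2^-1 * (a2 - b1)) := E1.
have {}E2 : 2^-1 * (a2 + b1) = m * (2^-1 * (a2 - b1)) + 0 * (2^-1 * (a1 - - b2)) := E2.
have n0 : 1 - m != 0 by rewrite gt_eqF //; lra.
rewrite [RHS]surjective_pairing /= /GRing.scale /=.
by congr pair; apply: (mulIf n0); rewrite mulrAC divfK //; lra.
Qed.

Lemma spiral_mu_no_solution : (\sum_(j <oo) ((K j)^-1)%:E < +oo)%E ->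
  ~ exists f, homeo_ACL_solution spiral_mu f.
Proof.
move=> sumK [f [hf [aclf beltf]]].
have c1 z := norm_spiral_coef z.
apply: (@beltrami_spiral_contradiction R f
  (fun z => (1 + spiral_coef z) / (1 - spiral_coef z)) K hf _ _ _ _ K1 sumK).
- by move=> a b c d sub; apply: aclf; apply: subset_trans sub _; exact: square_disk.
- have pt (z : R * R) : (disk z -> derivable f z ((1, 0)%R : R * R) /\ derivable f z ((0, 1)%R : R * R) /\
     dzbar f z = cmul (spiral_mu z) (dz f z)) -> central_square z ->
     [/\ derivable f z (1, 0), derivable f z (0, 1) & 'D_((1, 0) : R * R) f z =
      ((1 + spiral_coef z) / (1 - spiral_coef z)) *: mulNi ('D_((0, 1) : R * R) f z)].
    move=> H pz; have [d1 [d2 E]] := H (square_disk _ _ pz); split; [exact: d1|exact: d2|].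
    exact: (real_beltrami _ _ _ (c1 z) E).
  have [A [mA A0 HA]] := beltf; exists A; split; [exact: mA|exact: A0|move=> z nP].
  by apply: HA => H; apply: nP; exact: pt H.
- move=> z; have := c1 z; rewrite ltr_norml => /andP[? ?].
  by rewrite mulf_neq0 ?invr_eq0 // gt_eqF //; lra.
- move=> j z sz; rewrite (spiral_coefE j); last by exists z.
  have k := K1 j; rewrite /strip_coef; case: (odd j); rewrite ?expr0 ?expr1.
    have eq (x : R) : 1 <= x ->
      (1 + -1 * ((x - 1) / (x + 1))) / (1 - -1 * ((x - 1) / (x + 1))) = x^-1.
      by move=> x1; field; rewrite ?gt_eqF ?andbT //; lra.
    exact: eq.
  have eq (x : R) : 1 <= x ->
    (1 + 1 * ((x - 1) / (x + 1))) / (1 - 1 * ((x - 1) / (x + 1))) = x.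
    by move=> x1; field; rewrite ?gt_eqF ?andbT //; lra.
  exact: eq.
Qed.

End Coefficient.

(** * Choice of the dilatations *)

Section Growth.
Variable R : realType.
Local Notation mu := (@lebesgue_measure R).
Implicit Types Phi : \bar R -> \bar R.

Lemma sum_half_powers n : \sum_(j < n) (2^-1 : R) ^+ j <= 2.
Proof.
have -> : \sum_(j < n) (2^-1 : R) ^+ j = 2 - 2 * 2^-1 ^+ n.
  elim: n => [|n IH]; first by rewrite big_ord0 expr0; lra.
  by rewrite big_ord_recr /= IH exprS; lra.
by have : 0 <= (2^-1 : R) ^+ n by []; lra.
Qed.

Lemma sum_weighted_half_powers n : \sum_(m < n) (2^-1 : R) ^+ m * m%:R <= 2.
Proof.
have -> : \sum_(m < n) (2^-1 : R) ^+ m * m%:R = 2 - 2 * (n%:R + 1) * 2^-1 ^+ n.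
  elim: n => [|n IH]; first by rewrite big_ord0 expr0; lra.
  have eq (x p : R) : 2 - 2 * (x + 1) * p + p * x = 2 - 2 * (x + 1 + 1) * (2^-1 * p) by field.
  by rewrite big_ord_recr /= IH exprS (_ : n.+1%:R = n%:R + 1 :> R) ?eq // natr1.
by have : 0 <= 2 * (n%:R + 1) * (2^-1 : R) ^+ n by []; lra.
Qed.

Lemma sum_lt_leq n b : (\sum_(j < n) (j < b) <= b)%N.
Proof.
suff -> : (\sum_(j < n) (j < b) = minn n b)%N by exact: geq_minr.
by elim: n => [|n IH]; rewrite ?big_ord0 ?min0n // big_ord_recr /= IH; lia.
Qed.

(* [k j] is the largest [m <= j] with [a m <= j + a 0]; then [j < m + a m] for [m = k j + 1], and the
   double sum of [2 ^- m] over these pairs [(j, m)] converges. *)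
Lemma exists_slow_index (a : nat -> nat) (B : R) :
  (forall n, \sum_(m < n) 2^-1 ^+ m * (a m)%:R <= B) ->
  exists k : nat -> nat, (forall j, (a (k j) <= j + a 0)%N) /\
    (\sum_(j <oo) (2^-1 ^+ k j : R)%:E < +oo)%E.
Proof.
move=> aB; pose P j m := (m <= j)%N && (a m <= j + a 0)%N.
have ex j : exists m, P j m by exists 0%N; rewrite /P leq0n leq_addl.
have ub j m : P j m -> (m <= j)%N by case/andP.
pose k j := ex_maxn (ex j) (ub j).
have kP j : P j (k j) by rewrite /k; case: ex_maxnP.
have kmax j m : P j m -> (m <= k j)%N by rewrite /k; case: ex_maxnP => i _ H; exact: H.
exists k; split; first by move=> j; case/andP: (kP j).
have key j n : (j < n)%N ->
    2^-1 ^+ k j <= \sum_(m < n.+1) 2 * 2^-1 ^+ m * (j < m + a m)%:R :> R.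
  move=> jn; have kn : ((k j).+1 < n.+1)%N by case/andP: (kP j) => kj _; lia.
  rewrite (bigD1 (Ordinal kn)) //=.
  have -> : (j < (k j).+1 + a (k j).+1)%N.
    rewrite ltnNge; apply/negP => h; suff /kmax : P j (k j).+1 by rewrite ltnn.
    by apply/andP; split; lia.
  rewrite mulr1 exprS mulrA divff // mul1r lerDl.
  by apply: sumr_ge0 => m _; rewrite !mulr_ge0.
apply: (@le_lt_trans _ _ (2 * (2 + B))%:E); last exact: ltry.
apply: nneseries_le_bound => [j|n]; first by rewrite lee_fin.
rewrite sumEFin lee_fin.
apply: (@le_trans _ _ (\sum_(j < n) \sum_(m < n.+1) 2 * 2^-1 ^+ m * (j < m + a m)%:R)).
  by apply: ler_sum => j _; exact: key.
rewrite exchange_big /=.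
apply: (@le_trans _ _ (\sum_(m < n.+1) 2 * (2^-1 ^+ m * m%:R + 2^-1 ^+ m * (a m)%:R))).
  apply: ler_sum => m _; rewrite -mulr_sumr -natr_sum -mulrDr -natrD mulrA.
  by rewrite ler_wpM2l ?mulr_ge0 // ler_nat sum_lt_leq.
rewrite -mulr_sumr ler_wpM2l // big_split /=.
by apply: lerD; [exact: sum_weighted_half_powers|exact: aB].
Qed.

(** The sets where a monotone function is at least a given level are intervals. *)
Lemma nondecreasing_ereal_measurable (D : set R) (g : R -> \bar R) : is_interval D ->
  (forall x y, D x -> D y -> x <= y -> (g x <= g y)%E) -> measurable_fun D g.
Proof.
move=> iD gD; apply: (measurability (ErealGenCInfty.G (R := R))).
  exact: ErealGenCInfty.measurableE.
move=> _ [_ [r ->] <-]; apply: is_interval_measurable => x y [Dx gx] [Dy gy] z /andP[xz zy].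
have Dz : D z by apply: (iD _ _ Dx Dy); rewrite xz.
split => //; move: gx; rewrite /= !in_itv /= !andbT => /le_trans; apply.
exact: gD.
Qed.

Lemma eln_le (x y : \bar R) : (x <= y)%E -> (eln x <= eln y)%E.
Proof.
case: x => [x| |]; case: y => [y| |] //=; rewrite ?leey ?leNye //.
rewrite lee_fin => xy; case: ifP => x0; last by rewrite leNye.
by rewrite (lt_le_trans x0 xy) lee_fin ler_ln // posrE // (lt_le_trans x0).
Qed.

Lemma eln_ge0 (x : \bar R) : (1 <= x)%E -> (0 <= eln x)%E.
Proof. by move/eln_le; rewrite /eln /= ltr01 ln1. Qed.

(** On the dyadic interval starting at [2 ^ i], of length [2 ^ i], the integrand is at least its
    logarithm at the left end divided by [4 ^ (i + 1)]; hence each term of the sum is at most 4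
    times an integral. From [2 ^ m0] on the integrand is nonnegative, so an integral different from
    [+oo] is finite. *)
Lemma dyadic_log_sum Phi m0 : nondecr_on_ext Phi -> (1 <= Phi (2 ^+ m0)%:E)%E ->
  (\int[mu]_(t in `[(2 ^+ m0)%R, +oo[%classic) (eln (Phi t%:E) * (t ^- 2)%:E) <> +oo)%E ->
  exists B : R, forall n,
    (\sum_(i < n) eln (Phi (2 ^+ (m0 + i))%:E) * (2^-1 ^+ (m0 + i))%:E <= B%:E)%E.
Proof.
move=> Phile Phi1; set D : set R := `[2 ^+ m0, +oo[%classic.
pose F t : \bar R := (eln (Phi t%:E) * (t ^- 2)%:E)%E.
rewrite -/F => Ifin.
have m00 : 0 < 2 ^+ m0 :> R by rewrite exprn_gt0.
have DE t : D t -> 2 ^+ m0 <= t by rewrite /D /= in_itv /= andbT.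
have Dgt0 t : D t -> 0 < t by move/DE; apply: lt_le_trans.
have iD : is_interval D by exact: interval_is_interval.
have Phi_mono x y : D x -> D y -> x <= y -> (Phi x%:E <= Phi y%:E)%E.
  by move=> /Dgt0 x0 _ xy; apply: Phile; rewrite lee_fin // ltW.
have D0 : D (2 ^+ m0) by rewrite /D /= in_itv /= lexx.
have eln0 t : D t -> (0 <= eln (Phi t%:E))%E.
  by move=> Dt; apply: eln_ge0; apply: le_trans Phi1 _; apply: Phi_mono => //; exact: DE.
have F0 t : D t -> (0 <= F t)%E.
  by move=> Dt; rewrite mule_ge0 ?eln0 // lee_fin invr_ge0 exprn_ge0 // ltW // Dgt0.
have mF : measurable_fun D F.
  apply: emeasurable_funM.
    by apply: nondecreasing_ereal_measurable => // x y Dx Dy xy; apply: eln_le; exact: Phi_mono.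
  have -> : (fun t : R => (t ^- 2)%:E) = (fun t => - (- (t ^- 2))%:E)%E.
    by apply/funext => t; rewrite EFinN oppeK.
  apply: measurableT_comp => //; apply: nondecreasing_ereal_measurable => // x y Dx Dy xy.
  have x0 := Dgt0 _ Dx; have y0 := Dgt0 _ Dy.
  by rewrite lee_fin lerN2 lef_pV2 ?posrE ?exprn_gt0 // lerXn2r // nnegrE ltW.
pose I i : set R := `[2 ^+ (m0 + i), 2 ^+ (m0 + i).+1[%classic.
have mI i : measurable (I i) by exact: measurable_itv.
have pow_le i j : (i <= j)%N -> 2 ^+ i <= 2 ^+ j :> R by move=> ij; rewrite ler_eXn2l // ltr1n.
have ID i : I i `<=` D.
  move=> t; rewrite /I /D /= !in_itv /= andbT => /andP[h _].
  by apply: le_trans h; apply: pow_le; rewrite leq_addr.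
have tI : trivIset setT I.
  move=> i j _ _ [t []]; rewrite /I /= !in_itv /= => /andP[i1 i2] /andP[j1 j2].
  have := le_lt_trans i1 j2; have := le_lt_trans j1 i2.
  by rewrite !ltr_eXn2l ?ltr1n // => ? ?; lia.
have mD : measurable D by exact: measurable_itv.
have muI i : mu (I i) = (2 ^+ (m0 + i))%:E.
  rewrite /I lebesgue_measure_itv /= lte_fin ltr_eXn2l ?ltr1n // ltnSn.
  by rewrite -EFinB exprS; congr EFin; lra.
pose c i : \bar R := (eln (Phi (2 ^+ (m0 + i))%:E) * ((2 ^+ (m0 + i).+1) ^- 2)%:E)%E.
have DI i : D (2 ^+ (m0 + i)) by rewrite /D /= in_itv /= andbT pow_le // leq_addr.
have low i : (c i * mu (I i) <= \int[mu]_(t in I i) F t)%E.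
  have <- : (\int[mu]_(t in I i) c i = c i * mu (I i))%E
    by exact: (@integral_cst _ (measurableTypeR R) R mu (I i) (mI i)).
  apply: (@ge0_le_integral _ (measurableTypeR R) R mu (I i) (mI i)) => //.
  - by move=> t _; rewrite /c mule_ge0 ?eln0 // lee_fin invr_ge0 !exprn_ge0.
  - exact: (measurable_funS mD (ID i) mF).
  move=> t It; have Dt := ID _ _ It; have t0 := Dgt0 _ Dt.
  move: It; rewrite /I /= in_itv /= => /andP[t1 t2].
  apply: lee_pmul; [exact: eln0|by rewrite lee_fin invr_ge0 !exprn_ge0| |].
    by apply: eln_le; exact: Phi_mono.
  by rewrite lee_fin lef_pV2 ?posrE ?exprn_gt0 // lerXn2r // ?nnegrE ltW // exprn_gt0.
have total n : (\sum_(i < n) c i * mu (I i) <= \int[mu]_(t in D) F t)%E.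
  apply: (@le_trans _ _ (\int[mu]_(t in \bigcup_i I i) F t)%E); last first.
    apply: ge0_subset_integral => //; first exact: bigcupT_measurable.
    by move=> t [i _]; exact: ID.
  rewrite ge0_integral_bigcup //; last 2 first.
  - by apply: measurable_funS mF => // t [i _]; exact: ID.
  - by move=> t [i _ /ID]; exact: F0.
  apply: (@le_trans _ _ (\sum_(i < n) \int[mu]_(t in I i) F t)%E).
    by apply: lee_sum => i _; exact: low.
  rewrite -(big_mkord xpredT (fun i => \int[mu]_(t in I i) F t)%E).
  by apply: nneseries_lim_ge => i _ _; apply: integral_ge0 => t /ID; exact: F0.
have I0 : (0 <= \int[mu]_(t in D) F t)%E by exact: integral_ge0.
have Ifin' : (\int[mu]_(t in D) F t)%E \is a fin_num by rewrite ge0_fin_numE // ltey; apply/eqP.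
exists (4 * fine (\int[mu]_(t in D) F t)%E) => n.
rewrite EFinM fineK //.
have -> : (\sum_(i < n) eln (Phi (2 ^+ (m0 + i))%:E) * (2^-1 ^+ (m0 + i))%:E =
    4%:E * \sum_(i < n) c i * mu (I i))%E.
  rewrite ge0_sume_distrr; last first.
    by move=> i _; rewrite mule_ge0 // /c mule_ge0 ?eln0 // lee_fin invr_ge0 !exprn_ge0.
  apply: eq_bigr => i _; rewrite muI /c -muleA muleCA -!EFinM; congr (_ * EFin _)%E.
  have eq (x : R) : x != 0 -> x^-1 = 4 * ((2 * x) ^- 2 * x) by move=> x0; field.
  by rewrite exprVn [2 ^+ (m0 + i).+1]exprS; apply: eq; rewrite gt_eqF // exprn_gt0.
by apply: lee_wpmul2l.
Qed.

Lemma eln_dyadic (x : \bar R) : (1 <= x)%E -> (eln x < +oo)%E ->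
  exists a : nat, (x <= (2 ^+ a)%:E)%E /\ a%:R <= fine (eln x) / ln 2 + 1.
Proof.
case: x => [x| |] //; rewrite lee_fin => x1 _.
have x0 : 0 < x by lra.
have l2 : 0 < ln 2 :> R by rewrite ln_gt0 // ltr1n.
have l0 : 0 <= ln x / ln 2 by apply: divr_ge0; [exact: ln_ge0|exact: ltW].
have /andP[a1 a2] := truncn_itv l0.
have E : fine (eln x%:E) = ln x by rewrite /eln x0.
exists (Num.truncn (ln x / ln 2)).+1; rewrite E; split; last by rewrite -natr1 lerD2r.
rewrite lee_fin -ler_ln ?posrE ?exprn_gt0 // lnXn // -[ln 2 *+ _]mulr_natl -ler_pdivrMr //.
exact: ltW.
Qed.

Lemma dyadic_exponents Phi : nondecr_on_ext Phi ->
  (forall delta : R, 0 < delta ->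
    (\int[mu]_(t in `[delta, +oo[%classic) (eln (Phi t%:E) * (t ^- 2)%:E) <> +oo)%E) ->
  exists (a : nat -> nat) (B : R), (forall m, (Phi (2 ^+ m)%:E <= (2 ^+ a m)%:E)%E) /\
    (forall n, \sum_(m < n) 2^-1 ^+ m * (a m)%:R <= B).
Proof.
move=> Phile noint.
(* If [Phi] stays below 1 at all powers of 2, the exponent 0 serves throughout. Otherwise the
   logarithms are nonnegative from [m0] on. *)
have [[m0 Phim0]|H] := pselect (exists m, (1 <= Phi (2 ^+ m)%:E)%E); last first.
  exists (fun=> 0%N), 0; split => [m|n].
    by rewrite expr0; apply: ltW; rewrite ltNge; apply/negP => h; apply: H; exists m.
  by rewrite big1 // => m _; rewrite mulr0.
have [B HB] := dyadic_log_sum _ _ Phile Phim0 (noint _ (exprn_gt0 _ (ltr0n _ 2))).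
have pow_le i j : (i <= j)%N -> 2 ^+ i <= 2 ^+ j :> R by move=> ij; rewrite ler_eXn2l // ltr1n.
have Phi_le i j : (i <= j)%N -> (Phi (2 ^+ i)%:E <= Phi (2 ^+ j)%:E)%E.
  by move=> ij; apply: Phile; rewrite lee_fin ?exprn_ge0 ?pow_le.
have Phi1 i : (1 <= Phi (2 ^+ (m0 + i))%:E)%E by apply: le_trans Phim0 _; apply: Phi_le; exact: leq_addr.
have e0 i := eln_ge0 _ (Phi1 i).
have e_fin i : (eln (Phi (2 ^+ (m0 + i))%:E) < +oo)%E.
  rewrite ltNge leye_eq; apply/negP => /eqP E; have := HB i.+1.
  rewrite big_ord_recr /= E mulyr gtr0_sg ?exprn_gt0 // mul1e addey //.
  by rewrite gt_eqF // (lt_le_trans _ (sume_ge0 _ _)) // => j _; rewrite mule_ge0 // lee_fin.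
(* Below [m0] the exponent for [m0] is used, which is enough by monotonicity; these finitely many
   terms go into the bound separately. *)
have H m : exists n : nat, (Phi (2 ^+ maxn m0 m)%:E <= (2 ^+ n)%:E)%E /\
    n%:R <= fine (eln (Phi (2 ^+ maxn m0 m)%:E)) / ln 2 + 1.
  by rewrite maxnE; apply: eln_dyadic; [exact: Phi1|exact: e_fin].
have [a aP] := choice H.
exists a, (\sum_(m < m0) 2^-1 ^+ m * (a m)%:R + (B / ln 2 + 2)); split => [m|n].
  by apply: le_trans (aP m).1; apply: Phi_le; exact: leq_maxr.
have l2 : 0 < ln 2 :> R by rewrite ln_gt0 // ltr1n.
apply: (@le_trans _ _ (\sum_(m < m0 + n) 2^-1 ^+ m * (a m)%:R)).
  rewrite addnC big_split_ord /= lerDl.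
  by apply: sumr_ge0 => i _; rewrite mulr_ge0.
rewrite big_split_ord /= lerD2l.
pose L i := fine (eln (Phi (2 ^+ (m0 + i))%:E)).
apply: (@le_trans _ _ (\sum_(i < n) (L i * 2^-1 ^+ (m0 + i) / ln 2 + 2^-1 ^+ i))).
  apply: ler_sum => i _; have [_] := aP (m0 + i)%N.
  rewrite (maxn_idPr (leq_addr _ _)) -/(L i) => h.
  apply: (@le_trans _ _ (2^-1 ^+ (m0 + i) * (L i / ln 2 + 1))); first by rewrite ler_wpM2l.
  rewrite mulrDr mulr1 mulrA [_ * L i]mulrC lerD2l ler_wiXn2l ?leq_addl //.
  by rewrite invf_le1 // ler1n.
rewrite big_split /= lerD ?sum_half_powers // -mulr_suml.
apply: ler_wpM2r; first by rewrite invr_ge0 ltW.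
rewrite -lee_fin; apply: le_trans (HB n); rewrite -sumEFin; apply: lee_sum => i _.
by rewrite EFinM /L fineK // ge0_fin_numE.
Qed.

End Growth.

Theorem theorem5p1 (R : realType) (Phi : \bar R -> \bar R) :
  nonneg_on_ext Phi -> nondecr_on_ext Phi -> convex_on_ext Phi ->
  (forall mu : R * R -> R * R,
     measurable_fun (@disk R) mu ->
     (forall z, @disk R z -> @disk R (mu z)) ->
     (\int[@leb2 R]_(z in @disk R) Phi (Kmu mu z)%:E < +oo)%E ->
     exists f : R * R -> R * R, homeo_ACL_solution mu f) ->
  exists2 delta : R, 0 < delta &
    (\int[@lebesgue_measure R]_(t in `[delta, +oo[%classic)
        (eln (Phi t%:E) * (t ^- 2)%:E) = +oo)%E.
Proof.
move=> Phi0 Phile _ solv; apply: contrapT => noint.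
have [|a [B [aP aB]]] := dyadic_exponents R Phi Phile.
  by move=> delta d0 H; apply: noint; exists delta.
have [k [ka sumk]] := exists_slow_index R a B aB.
(* The choice of [k] balances two demands: [1 / K j] is summable, and [Phi (K j)] is at most
   [2 ^ a (k j)], hence at most [2 ^ (j + a 0)], which the areas [1 / 4 ^ j] turn into a geometric
   series. *)
pose K j : R := 2 ^+ k j.
have K1 j : 1 <= K j by rewrite exprn_ege1 // ler1n.
have sumK : (\sum_(j <oo) ((K j)^-1)%:E < +oo)%E.
  rewrite (@eq_eseriesr _ _ (fun j => (2^-1 ^+ k j)%:E)) // => j _.
  by rewrite /K exprVn.
apply: (spiral_mu_no_solution R K K1 sumK); apply: solv.
- exact: measurable_spiral_mu.
- by move=> z _; exact: disk_spiral_mu.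
apply: integral_Kmu_spiral => //.
  by apply: le_lt_trans (ltry (2 ^+ a 0)); exact: (aP 0%N).
apply: (@le_lt_trans _ _ (2 ^+ a 0 * 2)%:E); last exact: ltry.
have PhiK0 j : (0 <= Phi (K j)%:E)%E by apply: Phi0; rewrite lee_fin exprn_ge0.
apply: nneseries_le_bound => [j|n]; first by rewrite mule_ge0 // lee_fin.
apply: (@le_trans _ _ (\sum_(j < n) (2 ^+ a 0 * 2^-1 ^+ j)%:E)%E); last first.
  by rewrite sumEFin lee_fin -mulr_sumr ler_wpM2l ?sum_half_powers.
apply: lee_sum => j _.
have -> : (2 ^+ a 0 * 2^-1 ^+ j)%:E = ((2 ^+ (j + a 0))%:E * (4^-1 ^+ j)%:E)%E :> \bar R.
  have eq (x y z : R) : z != 0 -> x * z^-1 = z * x * (z * z)^-1 by move=> z0; field.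
  rewrite -EFinM; congr EFin; rewrite (_ : 4 = 2 * 2 :> R); last by lra.
  by rewrite !exprVn exprMn exprD; apply: eq => //; rewrite gt_eqF ?exprn_gt0.
apply: lee_wpmul2r; first by rewrite lee_fin.
apply: le_trans (aP (k j)) _; rewrite lee_fin ler_eXn2l ?ltr1n //.
Qed.
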